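(* Let $d\in\mathbb{N}$, $\beta>d$, and let $\mu$ be a probability density on $\mathbb{R}^d$ and $f^*:\mathbb{R}^d\to\{\pm1\}$ a target function satisfying the regularity assumption below. Then for every noise level $p\in(0,0.49)$, \[ C_1(\beta/d)\cdot p^{c(\beta/d)}~\leq~\mathcal{L}(\hat{h}_\beta)~\leq~C_2(\beta/d)\cdot\log^{\frac{1}{1-d/\beta}}(1/p)\cdot p, \] where $c(\beta/d)=\left(\frac{8\cdot 2^{\beta/d}}{\beta/d-1}\right)^{\frac{1}{\beta/d-1}}>0$ and $C_1(\beta/d),C_2(\beta/d)>0$ are constants depending only on the ratio $\beta/d$.
   Context: Training data $S=(\mathbf{x}_i,y_i)_{i=1}^m\subset\mathbb{R}^d\times\{\pm1\}$: the $\mathbf{x}_i$ are i.i.d. from the distribution $\mathcal{D}_\mathbf{x}$ with density $\mu$, and independently for each $i$, $y_i=f^*(\mathbf{x}_i)$ with probability $1-p$ and $y_i=-f^*(\mathbf{x}_i)$ with probability $p$. The Nadaraya–Watson interpolator is $\hat{h}_\beta(\mathbf{x})=\mathrm{sign}\big(\sum_{i=1}^m y_i\|\mathbf{x}-\mathbf{x}_i\|^{-\beta}\big)$ if $\mathbf{x}\notin\{\mathbf{x}_1,\dots,\mathbf{x}_m\}$, and $\hat{h}_\beta(\mathbf{x}_i)=y_i$. The asymptotic clean classification error is $\mathcal{L}(\hat{h}_\beta)=\lim_{m\to\infty}\mathbb{E}_S\big[\Pr_{\mathbf{x}\sim\mathcal{D}_\mathbf{x}}[\hat{h}_\beta(\mathbf{x})\neq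 f^*(\mathbf{x})]\big]$; if the limit does not exist, the lower bound is to be read for the $\liminf$ and the upper bound for the $\limsup$. Regularity assumption: $\mu$ is continuous at Lebesgue-almost every $\mathbf{x}\in\mathbb{R}^d$, and for Lebesgue-almost every $\mathbf{x}\in\mathbb{R}^d$ there is a neighborhood $B_\mathbf{x}\ni\mathbf{x}$ on which $f^*$ is constant (equal to $f^*(\mathbf{x})$). *)

(* Defs.v *)
From HB Require Import structures.
From mathcomp Require Import all_boot all_order all_algebra.
From mathcomp Require Import all_classical all_reals all_analysis.
Set Implicit Arguments. Unset Strict Implicit. Unset Printing Implicit Defensive.
Import Order.TTheory GRing.Theory Num.Theory.
Import numFieldNormedType.Exports.
Local Open Scope classical_set_scope.
Local Open Scope ring_scope.

Section NW.
Variable R : realType.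

(** Points of R^d are d-tuples of reals; (d.-tuple R) carries the product
    (= Borel) sigma-algebra of MathComp-Analysis. *)

Definition edist (d : nat) (x z : d.-tuple R) : R :=
  Num.sqrt (\sum_(i < d) (tnth x i - tnth z i) ^+ 2).

(** Lebesgue integral of a nonnegative function on R^d, written as the
    iterated one-dimensional Lebesgue integral (Tonelli). *)
Fixpoint lint (n : nat) : (n.-tuple R -> \bar R) -> \bar R :=
  match n return (n.-tuple R -> \bar R) -> \bar R with
  | 0 => fun f => f [tuple]
  | k.+1 => fun f =>
      (\int[@lebesgue_measure R]_x lint (fun t : k.-tuple R => f (cons_tuple x t)))%E
  end.

Definition leb_vol (d : nat) (A : set (d.-tuple R)) : \bar R :=
  lint (fun x => (\1_A x)%:E).

Definition leb_null (d : nat) (N : set (d.-tuple R)) : Prop :=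
  exists A : set (d.-tuple R), measurable A /\ N `<=` A /\ leb_vol A = 0%E.

Definition leb_ae (d : nat) (P : d.-tuple R -> Prop) : Prop :=
  leb_null [set x | ~ P x].

Definition cont_at (d : nat) (mu : d.-tuple R -> R) (x : d.-tuple R) : Prop :=
  forall e : R, 0 < e -> exists2 del : R, 0 < del &
    forall y, edist x y < del -> `|mu y - mu x| < e.

Definition loc_const_at (d : nat) (f : d.-tuple R -> R) (x : d.-tuple R) : Prop :=
  exists2 del : R, 0 < del & forall y, edist x y < del -> f y = f x.

Definition prob_density (d : nat) (mu : d.-tuple R -> R) : Prop :=
  (forall x, 0 <= mu x) /\ lint (fun x => (mu x)%:E) = 1%E.

Definition regular (d : nat) (mu : d.-tuple R -> R) (f : d.-tuple R -> R) : Prop :=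
  leb_ae (cont_at mu) /\ leb_ae (loc_const_at f).

Definition sample (d : nat) := seq (d.-tuple R * R)%type.

(** The Nadaraya-Watson interpolator hat h_beta built from the sample s.
    At a training point it returns the (first) corresponding label; elsewhere
    the sign of sum_i y_i ||x - x_i||^(-beta) (Num.sg, with sg 0 = 0). *)
Definition nw_interp (d : nat) (beta : R) (s : sample d) (x : d.-tuple R) : R :=
  let P := fun z : d.-tuple R * R => z.1 == x in
  if has P s then (nth (x, 0) s (find P s)).2
  else Num.sg (\sum_(z <- s) z.2 * (edist x z.1) `^ (- beta)).

Definition clean_err (d : nat) (mu f : d.-tuple R -> R) (beta : R) (s : sample d)
  : \bar R :=
  lint (fun x => (mu x * (if nw_interp beta s x != f x then 1 else 0))%:E).

(** E_S[F S] where S = (x_i, y_i)_{i<m}, the x_i i.i.d. with density mu and,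
    independently for each i, y_i = f(x_i) w.p. 1-p and y_i = -f(x_i) w.p. p. *)
Fixpoint sample_exp (d : nat) (mu f : d.-tuple R -> R) (p : R) (m : nat)
  (F : sample d -> \bar R) : \bar R :=
  match m with
  | 0 => F [::]
  | k.+1 => lint (fun x =>
      ((mu x)%:E *
        ((1 - p)%:E * sample_exp mu f p k (fun s => F ((x, f x) :: s)) +
         p%:E * sample_exp mu f p k (fun s => F ((x, (- f x)%R) :: s)))))%E
  end.

Definition exp_err (d : nat) (mu f : d.-tuple R -> R) (p beta : R) (m : nat)
  : \bar R :=
  sample_exp mu f p m (clean_err mu f beta).

Definition c_exp (r : R) : R := (8 * 2 `^ r / (r - 1)) `^ (1 / (r - 1)).

End NW.

(* Main.v *)
Require Import Defs.
From HB Require Import structures.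
From mathcomp Require Import all_boot all_order all_algebra.
From mathcomp Require Import all_classical all_reals all_analysis.
From mathcomp Require Import measurable_realfun ring lra.
Set Implicit Arguments. Unset Strict Implicit. Unset Printing Implicit Defensive.
Import Order.TTheory GRing.Theory Num.Theory.
Import numFieldNormedType.Exports.
Local Open Scope classical_set_scope.
Local Open Scope ring_scope.

(** Fix a point [x] with [mu x > 0] at which [mu] is continuous and [f] locally
    constant, and put [r = beta / d], [w_i = ||x - x_i||^d], so that the vote of
    the i-th sample point has weight [w_i^-r] and, for small [s],
    [P (0 < w_i <= s)] lies between [ka * s / 2] and [2 * ka * s].

    Upper bound.  With [T = 2 ln (1/p)], [B = T^(r/(r-1))], an error at [x] forces
    either that no point satisfies [w_i <= T/(ka m)] (probability at most [p]), or
    that a flipped point satisfies [w_i <= B/(ka m)] (probability at most [2 B p]),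
    or that the flipped points beyond this radius outweigh a point at distance
    [T/(ka m)]; by Markov's inequality this last event has probability [O(p)],
    because the expected weight already carries the factor [p].

    Lower bound.  If [a] is a small constant, then with probability at least
    [a p / 4] there is exactly one point with [w_i <= a/(ka m)], it is flipped, and
    it outweighs all the others.  Hence the error is at least [C1 p], and
    [p^c <= p] because [c >= 1].

    Both estimates are expectations of sums over the points or over pairs of
    points.  Tonelli's theorem and dominated convergence then transfer them from
    almost every [x] to the expected clean error. *)

(** * Integrals of arbitrary nonnegative functions *)

Section lower_integral.
Local Open Scope ereal_scope.
Context d (T : measurableType d) (R : realType).
Variable m : {measure set T -> \bar R}.

Import HBNNSimple.

(** The integral of a nonnegative function is a supremum over the simple functions below it, and a
    larger function has more of them. Integrands built from [mu] and [f], which are not assumed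
    measurable, are compared this way. *)
Lemma ge0_le_integral_any (f g : T -> \bar R) :
  (forall x, 0 <= f x) -> (forall x, f x <= g x) ->
  \int[m]_x f x <= \int[m]_x g x.
Proof.
move=> f0 fg; have g0 x : 0 <= g x by apply: le_trans (fg x).
rewrite !ge0_integralTE//; apply: ereal_sup_le => _ [h /= hf <-].
by exists h => //= x; apply: le_trans (fg x).
Qed.

(** A simple function below [f] keeps its integral when it is set to 0 on the null set [N], and the
    function so obtained lies below [g]. *)
Lemma ge0_null_le_integral_any (N : set T) (f g : T -> \bar R) :
  measurable N -> m N = 0 ->
  (forall x, 0 <= f x) -> (forall x, 0 <= g x) ->
  (forall x, ~ N x -> f x = g x) ->
  \int[m]_x f x <= \int[m]_x g x.
Proof.
move=> mN N0 f0 g0 fg; rewrite (ge0_integralTE _ f0).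
apply: ge_ereal_sup => _ [h /= hf <-].
have mNC : measurable (~` N) by exact: measurableC.
have mhE : measurable_fun setT (EFin \o h) by apply/measurable_EFinP; exact: measurable_funP.
rewrite -integralT_nnsfun (ge0_negligible_integral mN)//; last first.
  by move=> x _; rewrite lee_fin.
rewrite setTD integral_mkcond.
apply: ge0_le_integral_any => x; rewrite patchE; case: ifPn => //.
- by rewrite lee_fin.
- by rewrite inE => Nx; rewrite -fg.
Qed.

Lemma ge0_null_eq_integral_any (N : set T) (f g : T -> \bar R) :
  measurable N -> m N = 0 ->
  (forall x, 0 <= f x) -> (forall x, 0 <= g x) ->
  (forall x, ~ N x -> f x = g x) ->
  \int[m]_x f x = \int[m]_x g x.
Proof.
move=> mN N0 f0 g0 fg; apply/eqP; rewrite eq_le; apply/andP; split;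
apply: (ge0_null_le_integral_any mN) => // x Nx; exact/esym/fg.
Qed.

End lower_integral.

(** * Measures given by a density *)

Section density.
Local Open Scope ereal_scope.
Context d (T : measurableType d) (R : realType).
Variable m : {measure set T -> \bar R}.
Variables (h : T -> R) (mh : measurable_fun setT h) (h0 : forall x, (0 <= h x)%R).

Definition mdensity (A : set T) : \bar R := \int[m]_(x in A) (h x)%:E.

Let mdensity0 : mdensity set0 = 0.
Proof. by rewrite /mdensity integral_set0. Qed.

Let mdensity_ge0 A : 0 <= mdensity A.
Proof. by apply: integral_ge0 => x _; rewrite lee_fin. Qed.

Let mdensity_sigma_additive : semi_sigma_additive mdensity.
Proof.
move=> F mF tF mUF; rewrite /mdensity ge0_integral_bigcup//; last 2 first.
- by apply/measurable_EFinP; apply: measurable_funS mh.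
- by move=> x _; rewrite lee_fin.
by apply: is_cvg_ereal_nneg_natsum => n _; exact: mdensity_ge0.
Qed.

HB.instance Definition _ := isMeasure.Build _ _ _ mdensity
  mdensity0 mdensity_ge0 mdensity_sigma_additive.

Import HBNNSimple.

(** Monotone convergence on both sides reduces the formula to simple functions, then to indicators,
    where it is the definition of [mdensity]. *)
Lemma integral_mdensity (f : T -> \bar R) :
  measurable_fun setT f -> (forall x, 0 <= f x) ->
  \int[mdensity]_x f x = \int[m]_x ((h x)%:E * f x).
Proof.
move=> mf f0; have mhE : measurable_fun setT (EFin \o h) by exact/measurable_EFinP.
pose f_ := nnsfun_approx measurableT mf.
transitivity (limn (fun n => \int[mdensity]_x (f_ n x)%:E)).
  rewrite -monotone_convergence//=.
  - apply: eq_integral => x _; apply/esym/cvg_lim => //=.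
    exact: cvg_nnsfun_approx.
  - by move=> n; exact/measurable_EFinP/measurable_funP.
  - by move=> n x _; rewrite lee_fin.
  - by move=> x _ a b ab; rewrite lee_fin; exact/lefP/nd_nnsfun_approx.
rewrite (_ : (fun n => _) = (fun n => \int[m]_x ((h x)%:E * (f_ n x)%:E))).
  rewrite -monotone_convergence//=.
  - apply: eq_integral => x _; apply/cvg_lim => //=.
    by apply: cvgeZl => //; exact: cvg_nnsfun_approx.
  - move=> n; apply: emeasurable_funM => //.
    exact/measurable_EFinP/measurable_funP.
  - by move=> n x _; rewrite mule_ge0// lee_fin.
  - move=> x _ a b ab; apply: lee_wpmul2l; rewrite lee_fin//.
    exact/lefP/nd_nnsfun_approx.
apply/funext => n.
transitivity (\int[mdensity]_x (\sum_(r \in range (f_ n))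
    (r * \1_(f_ n @^-1` [set r]) x)%:E)).
  by apply: eq_integral => x _; rewrite fsumEFin// -fimfunE.
transitivity (\int[m]_x (\sum_(r \in range (f_ n))
    ((h x)%:E * (r * \1_(f_ n @^-1` [set r]) x)%:E))); last first.
  apply: eq_integral => x _; rewrite -ge0_mule_fsumr; last first.
    by move=> r; rewrite EFinM nnfun_muleindic_ge0.
  by rewrite fsumEFin// -fimfunE.
have mI r : measurable_fun setT (fun x => (r * \1_(f_ n @^-1` [set r]) x)%:E).
  apply/measurable_EFinP/measurable_funM => //.
rewrite ge0_integral_fsum//; last first.
  by move=> r x _; rewrite EFinM nnfun_muleindic_ge0.
rewrite ge0_integral_fsum//; last 2 first.
- by move=> r; apply: emeasurable_funM.
- by move=> r x _; apply: mule_ge0; rewrite ?lee_fin// -lee_fin EFinM nnfun_muleindic_ge0.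
apply: eq_fsbigr => r _.
rewrite integralZl_indic_nnsfun// integral_indic// setIT.
under [RHS]eq_integral do rewrite EFinM muleCA.
(* For [r < 0] the preimage under a nonnegative simple function is empty and both sides vanish. *)
have [r0|r0] := leP 0%R r; last first.
  rewrite preimage_nnfun0// measure0 mule0.
  by rewrite integral0_eq// => x _; rewrite indic0 mule0 mule0.
rewrite ge0_integralZl_EFin//; last 2 first.
- by move=> x _; rewrite mule_ge0 ?lee_fin.
- by apply: emeasurable_funM => //; apply/measurable_EFinP; exact: measurable_indic.
congr (_ * _); rewrite -[LHS]/(\int[m]_(x in f_ n @^-1` [set r]) (h x)%:E).
rewrite integral_mkcond; apply: eq_integral => x _.
by rewrite patchE indicE; case: ifP; rewrite ?mule1 ?mule0.
Qed.

End density.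

(** * Images of sigma-finite measures *)

Section transport.
Local Open Scope ereal_scope.
Context d1 d2 (X : measurableType d1) (Y : measurableType d2) (R : realType).
Variable m : {measure set X -> \bar R}.
Hypothesis sfm : sigma_finite setT m.
Variables (phi : X -> Y) (psi : Y -> X).
Hypotheses (mphi : measurable_fun setT phi) (mpsi : measurable_fun setT psi).
Hypothesis phiK : cancel phi psi.

(** The measure is the pushforward by [phi]. The left inverse [psi] keeps it sigma-finite: an
    exhaustion [F] pulls back to the sets [psi^-1 (F n)], whose pushforward measure is again
    [m (F n)]. *)
Lemma sigma_finite_transport :
  exists m' : {sigma_finite_measure set Y -> \bar R},
    forall f : Y -> \bar R, measurable_fun setT f -> (forall y, 0 <= f y) ->
      \int[m']_y f y = \int[m]_x f (phi x).
Proof.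
pose pf : {measure set Y -> \bar R} := pushforward m phi.
pose p := pf mphi.
have psf : sigma_finite setT p.
  have [F FT Fm] := sfm.
  exists (fun n => psi @^-1` F n).
    apply/esym; rewrite -subTset => y _.
    have : [set: X] (psi y) by []. 
    by rewrite FT => -[n _ Fn]; exists n.
  move=> n; have [mF fF] := Fm n; split.
    by rewrite -[X in measurable X]setTI; exact: mpsi.
  rewrite /p/= /pushforward/=; congr (_ < _): fF; congr (m _).
  by apply/seteqP; split => x /=; rewrite phiK.
pose p' : {sigma_finite_measure set Y -> \bar R} :=
  HB.pack (Measure.sort p) (Measure_isSigmaFinite.Build _ _ _ _ psf).
exists p' => f mf f0.
by rewrite (@ge0_integral_pushforward _ _ _ _ _ phi mphi m setT f)// => y _.
Qed.

End transport.

(** * Product measures and their images *)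

Section product_transport.
Local Open Scope ereal_scope.


(** Both exhaustions are taken increasing, so that a point of [F i] times [G j] lies in the product
    of the two sets at the larger index. *)
Lemma sigma_finite_product d1 d2 (X1 : measurableType d1)
    (X2 : measurableType d2) (R : realType)
    (m1 : {sigma_finite_measure set X1 -> \bar R})
    (m2 : {sigma_finite_measure set X2 -> \bar R}) :
  sigma_finite setT (m1 \x m2)%E.
Proof.
have /sigma_finiteP[F [FT /= ndF Foo]] := sigma_finiteT m1.
have /sigma_finiteP[G [GT /= ndG Goo]] := sigma_finiteT m2.
exists (fun n => F n `*` G n) => [|n].
  rewrite -setXTT FT GT; apply/seteqP; split=> [[x y] [[i _ Fi] [j _ Gj]]|].
    exists (maxn i j) => //; split.
      by move: (x) Fi; exact/subsetPset/ndF/leq_maxl.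
    by move: (y) Gj; exact/subsetPset/ndG/leq_maxr.
  by move=> [x y] [i _ [Fi Gi]]; split; exists i.
have [mF F_oo] := Foo n; have [mG G_oo] := Goo n.
split; first exact: measurableX.
by rewrite product_measure1E// lte_mul_pinfty// ge0_fin_numE.
Qed.

(** Tonelli's theorem for an image of a product. It serves twice: to add a coordinate to a tuple,
    and to attach a label-flipping coin to a point. *)
Lemma sigma_finite_product_transport d1 d2 d3 (X1 : measurableType d1)
    (X2 : measurableType d2) (Y : measurableType d3) (R : realType)
    (m1 : {sigma_finite_measure set X1 -> \bar R})
    (m2 : {sigma_finite_measure set X2 -> \bar R})
    (phi : X1 * X2 -> Y) (psi : Y -> X1 * X2) :
  measurable_fun setT phi -> measurable_fun setT psi -> cancel phi psi ->
  exists m' : {sigma_finite_measure set Y -> \bar R},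
    forall f : Y -> \bar R, measurable_fun setT f -> (forall y, 0 <= f y) ->
      \int[m']_y f y = \int[m1]_x \int[m2]_y f (phi (x, y)).
Proof.
move=> mphi mpsi phiK.
have [m' m'E] := sigma_finite_transport (sigma_finite_product m1 m2) mphi mpsi phiK.
exists m' => f mf f0; rewrite m'E// (fubini_tonelli1 (f \o phi))//.
  exact: measurableT_comp.
by move=> y; exact: f0.
Qed.

End product_transport.

(** * The iterated integral as integration against a measure *)

Section lint_theory.
Local Open Scope ereal_scope.
Context (R : realType).

Lemma lint_ge0 n (f : n.-tuple R -> \bar R) : (forall x, 0 <= f x) -> 0 <= lint f.
Proof.
elim: n f => [|n IH] f f0 /=; first exact: f0.
by apply: integral_ge0 => x _; apply: IH => t; exact: f0.
Qed.

Lemma le_lint n (f g : n.-tuple R -> \bar R) :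
  (forall x, 0 <= f x) -> (forall x, f x <= g x) -> lint f <= lint g.
Proof.
elim: n f g => [|n IH] f g f0 fg /=; first exact: fg.
apply: ge0_le_integral_any => x; first exact: lint_ge0.
by apply: IH => t; [exact: f0|exact: fg].
Qed.

Lemma eq_lint n (f g : n.-tuple R -> \bar R) : f =1 g -> lint f = lint g.
Proof. by move=> /funext ->. Qed.

Lemma measurable_cons_pair n :
  measurable_fun setT (fun p : R * n.-tuple R => cons_tuple p.1 p.2).
Proof.
apply: (@measurable_cons _ _ _ _ (fst : R * n.-tuple R -> R) n snd).
- exact: measurable_fst.
- exact: measurable_snd.
Qed.

Lemma measurable_cons_at n (x : R) :
  measurable_fun setT (fun t : n.-tuple R => cons_tuple x t).
Proof. exact: (@measurable_cons _ _ _ _ (fun=> x) n id). Qed.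

Lemma measurable_uncons n :
  measurable_fun setT (fun t : n.+1.-tuple R => (thead t, [tuple of behead t])).
Proof.
apply: measurable_fun_pair; first exact: (measurable_tnth ord0).
exact: measurable_behead.
Qed.

(** By induction: a Dirac mass in dimension 0, then the image under [cons_tuple] of Lebesgue measure
    times the previous measure. Through it Tonelli's theorem and dominated convergence become
    available for [lint]. *)
Lemma lint_measure n : exists m : {sigma_finite_measure set (n.-tuple R) -> \bar R},
  forall f, measurable_fun setT f -> (forall x, 0 <= f x) ->
    lint f = \int[m]_x f x.
Proof.
elim: n => [|n [m mE]].
  exists (\d_ ([tuple] : 0.-tuple R)) => f mf f0 /=.
  by rewrite integral_dirac// diracT mul1e.
have consK : cancel (fun p : R * n.-tuple R => cons_tuple p.1 p.2)
   (fun t : n.+1.-tuple R => (thead t, [tuple of behead t])).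
  move=> [a t] /=; congr pair; apply: val_inj => //.
have [m' m'E] := sigma_finite_product_transport (@lebesgue_measure R) m
   (@measurable_cons_pair n) (@measurable_uncons n) consK.
exists m' => f mf f0; rewrite m'E//=.
have mfc := measurableT_comp mf (@measurable_cons_pair n).
apply: eq_integral => x _; rewrite mE//.
exact: (measurableT_comp mf (measurable_cons_at x)).
Qed.

(** By Tonelli's theorem almost every slice of a null set is null, so the induction hypothesis
    applies slice by slice. The functions may be non-measurable, as integrands containing [mu] and
    [f] can be. *)
Lemma lint_null_eq n (A : set (n.-tuple R)) (f g : n.-tuple R -> \bar R) :
  measurable A -> leb_vol A = 0 ->
  (forall x, 0 <= f x) -> (forall x, 0 <= g x) ->
  (forall x, ~ A x -> f x = g x) -> lint f = lint g.
Proof.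
elim: n A f g => [|n IH] A f g mA A0 f0 g0 fg /=.
  apply: fg => A1; move: A0; rewrite /leb_vol/= indicE mem_set//.
  by move=> /eqP; rewrite eqe oner_eq0.
have [m mE] := lint_measure n.
pose h (p : R * n.-tuple R) := (\1_A (cons_tuple p.1 p.2) : R)%:E.
have mh : measurable_fun setT h.
  apply/measurable_EFinP; apply: (measurableT_comp _ (@measurable_cons_pair n)).
  exact: measurable_indic.
have h0 p : 0 <= h p by rewrite lee_fin.
have hE x : leb_vol [set t | A (cons_tuple x t)] = \int[m]_t h (x, t).
  rewrite -mE//.
  by apply/measurable_EFinP; apply: (measurableT_comp _ (measurable_cons_at x)).
have mF := measurable_fun_fubini_tonelli_F (m2 := m) h mh h0.
have F0 : \int[@lebesgue_measure R]_x `|fubini_F m h x| = 0.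
  rewrite -A0 /leb_vol/=; apply: eq_integral => x _.
  by rewrite gee0_abs; [exact/esym/hE|exact: integral_ge0].
(* [N] contains every first coordinate whose slice of [A] has positive volume. *)
have [/(_ F0) [N [mN N0 NF]] _] := ae_eq_integral_abs (@lebesgue_measure R) measurableT mF.
apply: (ge0_null_eq_integral_any mN N0) => x; try exact: lint_ge0.
move=> Nx; apply: (IH [set t | A (cons_tuple x t)]) => //.
- rewrite -[X in measurable X]setTI.
  exact: measurable_cons_at.
- rewrite hE; apply: contrapT => hx; apply: Nx; apply: NF => /= /(_ I).
  exact: hx.
- by move=> t; exact: fg.
Qed.

End lint_theory.

(** * Expectations over independent samples *)

Section iterated_expectation.
Local Open Scope ereal_scope.
Context d (Z : measurableType d) (R : realType).
Variable Q : {sigma_finite_measure set Z -> \bar R}.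

(** The expectation over [m] independent draws from [Q], built with the same recursion as
    [sample_exp]. *)
Fixpoint iexp (m : nat) (F : seq Z -> \bar R) : \bar R :=
  if m is k.+1 then \int[Q]_z iexp k (fun s => F (z :: s)) else F [::].

Lemma iexp_ge0 m F : (forall s, 0 <= F s) -> 0 <= iexp m F.
Proof.
elim: m F => [|m IH] F F0 /=; first exact: F0.
by apply: integral_ge0 => z _; apply: IH => s; exact: F0.
Qed.

Lemma le_iexp m F G : (forall s, 0 <= F s) -> (forall s, F s <= G s) ->
  iexp m F <= iexp m G.
Proof.
elim: m F G => [|m IH] F G F0 FG /=; first exact: FG.
apply: ge0_le_integral_any => z; first by apply: iexp_ge0 => s; exact: F0.
by apply: IH => s; [exact: F0|exact: FG].
Qed.

(** The parameter space [A] varies in the induction: the first draw is absorbed into the parameter,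
    which then ranges over [A * Z]. *)
Lemma measurable_iexp m d' (A : measurableType d') (F : A -> seq Z -> \bar R) :
  (forall a s, 0 <= F a s) ->
  measurable_fun setT (fun p : A * m.-tuple Z => F p.1 p.2) ->
  measurable_fun setT (fun a => iexp m (F a)).
Proof.
elim: m d' A F => [|m IH] d' A F F0 mF /=.
  exact: (measurableT_comp mF (@measurable_pair2 _ _ A _ ([tuple] : 0.-tuple Z))).
have mG : measurable_fun setT
    (fun p : A * Z => iexp m (fun s => F p.1 (p.2 :: s))).
  apply: (IH _ _ (fun p s => F p.1 (p.2 :: s))) => [p s|]; first exact: F0.
  pose c (q : A * Z * m.-tuple Z) := (q.1.1, cons_tuple q.1.2 q.2).
  have mc : measurable_fun setT c.
    apply: measurable_fun_pair.
      by apply: measurableT_comp => //; exact: measurable_fst.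
    apply: (@measurable_cons _ _ _ _ (fun q : A * Z * m.-tuple Z => q.1.2) m snd).
      by apply: (measurableT_comp measurable_snd); exact: measurable_fst.
    exact: measurable_snd.
  exact: (measurableT_comp mF mc).
apply: (measurable_fun_fubini_tonelli_F (fun p : A * Z => iexp m (fun s => F p.1 (p.2 :: s)))) => //.
by move=> p; apply: iexp_ge0 => s; exact: F0.
Qed.

(** One application of Tonelli's theorem per draw. *)
Lemma integral_iexp m d' (A : measurableType d')
    (l : {sigma_finite_measure set A -> \bar R}) (F : A -> seq Z -> \bar R) :
  (forall a s, 0 <= F a s) ->
  measurable_fun setT (fun p : A * m.-tuple Z => F p.1 p.2) ->
  \int[l]_a iexp m (F a) = iexp m (fun s => \int[l]_a F a s).
Proof.
elim: m F => [//|m IH] F F0 mF /=.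
have mG : measurable_fun setT
    (fun p : A * Z => iexp m (fun s => F p.1 (p.2 :: s))).
  apply: (@measurable_iexp _ _ _ (fun p s => F p.1 (p.2 :: s))) => [p s|]; first exact: F0.
  pose c (q : A * Z * m.-tuple Z) := (q.1.1, cons_tuple q.1.2 q.2).
  have mc : measurable_fun setT c.
    apply: measurable_fun_pair.
      by apply: measurableT_comp => //; exact: measurable_fst.
    apply: (@measurable_cons _ _ _ _ (fun q : A * Z * m.-tuple Z => q.1.2) m snd).
      by apply: (measurableT_comp measurable_snd); exact: measurable_fst.
    exact: measurable_snd.
  exact: (measurableT_comp mF mc).
rewrite (fubini_tonelli (fun p : A * Z => iexp m (fun s => F p.1 (p.2 :: s))))//=; last first.
  by move=> p; apply: iexp_ge0 => s; exact: F0.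
apply: eq_integral => z _; apply: (IH (fun a s => F a (z :: s))) => [a s|].
  exact: F0.
pose c (q : A * m.-tuple Z) := (q.1, cons_tuple z q.2).
have mc : measurable_fun setT c.
  apply: measurable_fun_pair; first exact: measurable_fst.
  apply: (@measurable_cons _ _ _ _ (fun _ : A * m.-tuple Z => z) m snd).
    exact: measurable_cst.
  exact: measurable_snd.
exact: (measurableT_comp mF mc).
Qed.

(** Measurability is tested on each fixed length, where the product sigma-algebra of tuples is
    available. *)
Definition seq_measurable (F : seq Z -> \bar R) :=
  forall m, measurable_fun setT (fun t : m.-tuple Z => F t).

Lemma seq_measurable_cons F z : seq_measurable F -> seq_measurable (fun s => F (z :: s)).
Proof.
move=> mF m.
exact: (measurableT_comp (mF m.+1) (@measurable_cons _ _ _ _ (fun=> z) m id _ _)).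
Qed.

Lemma measurable_iexp_cons m F : (forall s, 0 <= F s) -> seq_measurable F ->
  measurable_fun setT (fun z => iexp m (fun s => F (z :: s))).
Proof.
move=> F0 mF; apply: (measurable_iexp (F := fun z s => F (z :: s))) => //.
apply: (measurableT_comp (mF m.+1) (@measurable_cons _ _ _ _ (fst : Z * m.-tuple Z -> Z) m snd _ _)).
  exact: measurable_fst.
exact: measurable_snd.
Qed.

Lemma iexpD m F G : (forall s, 0 <= F s) -> (forall s, 0 <= G s) ->
  seq_measurable F -> seq_measurable G ->
  iexp m (fun s => F s + G s) = iexp m F + iexp m G.
Proof.
elim: m F G => [//|m IH] F G F0 G0 mF mG /=.
rewrite -ge0_integralD//; last 4 first.
- by move=> z _; apply: iexp_ge0.
- exact: measurable_iexp_cons.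
- by move=> z _; apply: iexp_ge0.
- exact: measurable_iexp_cons.
by apply: eq_integral => z _; apply: IH => //; exact: seq_measurable_cons.
Qed.

Lemma iexpZ m F (c : R) : (0 <= c)%R -> (forall s, 0 <= F s) -> seq_measurable F ->
  iexp m (fun s => c%:E * F s) = c%:E * iexp m F.
Proof.
move=> c0; elim: m F => [//|m IH] F F0 mF /=.
rewrite -ge0_integralZl_EFin//; last 2 first.
- by move=> z _; apply: iexp_ge0.
- exact: measurable_iexp_cons.
by apply: eq_integral => z _; apply: IH => //; exact: seq_measurable_cons.
Qed.

Lemma seq_measurable_sum (g : Z -> R) : measurable_fun setT g ->
  seq_measurable (fun s => (\sum_(z <- s) g z)%:E).
Proof.
move=> mg m; apply/measurable_EFinP.
rewrite (_ : (fun t : m.-tuple Z => \sum_(z <- t) g z)%R =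
    (fun t => \sum_(i < m) g (tnth t i))%R); last first.
  by apply/funext => t; rewrite big_tuple.
apply: measurable_sum => i; apply: measurableT_comp => //.
exact: measurable_tnth.
Qed.

Lemma seq_measurable_prod (g : Z -> R) : measurable_fun setT g ->
  seq_measurable (fun s => (\prod_(z <- s) g z)%:E).
Proof.
move=> mg m; apply/measurable_EFinP.
rewrite (_ : (fun t : m.-tuple Z => \prod_(z <- t) g z)%R =
    (fun t => \prod_(i < m) g (tnth t i))%R); last first.
  by apply/funext => t; rewrite big_tuple.
apply: measurable_prod => i _; apply: measurableT_comp => //.
exact: measurable_tnth.
Qed.

Lemma seq_measurable_mul (F G : seq Z -> R) :
  seq_measurable (EFin \o F) -> seq_measurable (EFin \o G) ->
  seq_measurable (fun s => (F s * G s)%:E).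
Proof.
move=> mF mG m; apply/measurable_EFinP; apply: measurable_funM.
  by apply/measurable_EFinP; exact: mF.
by apply/measurable_EFinP; exact: mG.
Qed.

Lemma seq_measurable_test (g : Z -> R) (b : R -> bool) :
  measurable_fun setT b -> measurable_fun setT g ->
  seq_measurable (fun s => (if b (\sum_(z <- s) g z)%R then 1%R else 0%R)%:E).
Proof.
move=> mb mg m; apply/measurable_EFinP; apply: measurable_fun_ifT => //.
apply: (measurableT_comp mb); apply/measurable_EFinP; exact: seq_measurable_sum.
Qed.

Hypothesis Q1 : Q setT = 1.

Lemma integral_Qcst (c : R) : \int[Q]_z c%:E = c%:E.
Proof. by rewrite -[RHS]mule1 -Q1; exact: integral_cst. Qed.

(** The one-draw computation behind the formulas below: after integrating out the other draws, sums
    and products over the sample are affine in functions of the first draw. *)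
Lemma integral_affine (q f : Z -> R) (eq ef a b c : R) :
  (0 <= a)%R -> (0 <= b)%R -> (0 <= c)%R ->
  measurable_fun setT q -> measurable_fun setT f ->
  (forall z, 0 <= q z)%R -> (forall z, 0 <= f z)%R ->
  \int[Q]_z (q z)%:E = eq%:E -> \int[Q]_z (f z)%:E = ef%:E ->
  \int[Q]_z (c + a * q z + b * f z)%:E = (c + a * eq + b * ef)%:E.
Proof.
move=> a0 b0 c0 mq mf q0 f0 qE fE.
have mqE : measurable_fun setT (EFin \o q) by exact/measurable_EFinP.
have mfE : measurable_fun setT (EFin \o f) by exact/measurable_EFinP.
under eq_integral do rewrite !EFinD !EFinM.
rewrite ge0_integralD//; last 4 first.
- by move=> z _; rewrite -!EFinM -EFinD lee_fin addr_ge0// mulr_ge0.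
- by apply: emeasurable_funD => //; apply: emeasurable_funM.
- by move=> z _; rewrite -!EFinM lee_fin mulr_ge0.
- by apply: emeasurable_funM.
rewrite ge0_integralD//; last 2 first.
- by move=> z _; rewrite -!EFinM lee_fin mulr_ge0.
- by apply: emeasurable_funM.
rewrite integral_Qcst !ge0_integralZl_EFin//; try by move=> z _; rewrite lee_fin.
by rewrite qE fE -!EFinM -!EFinD.
Qed.

Lemma iexp_cst m (c : R) : iexp m (fun=> c%:E) = c%:E.
Proof.
elim: m => [//|m IH] /=; rewrite -[RHS]integral_Qcst; exact: eq_integral.
Qed.

Lemma iexp_sum m (g : Z -> R) (e : R) : measurable_fun setT g ->
  (forall z, 0 <= g z)%R -> \int[Q]_z (g z)%:E = e%:E ->
  iexp m (fun s => (\sum_(z <- s) g z)%:E) = (m%:R * e)%:E.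
Proof.
move=> mg g0 gE; elim: m => [|m IH] /=; first by rewrite big_nil mul0r.
have e0 : (0 <= e)%R by rewrite -lee_fin -gE; apply: integral_ge0 => z _; rewrite lee_fin.
transitivity (\int[Q]_z (m%:R * e + 1 * g z + 0 * g z)%:E); last first.
  rewrite (integral_affine (eq := e) (ef := e))//; last by rewrite mulr_ge0.
  by congr _%:E; rewrite -natr1; lra.
apply: eq_integral => z _.
under [in LHS]eq_fun do rewrite big_cons EFinD.
rewrite iexpD.
- by rewrite iexp_cst IH -EFinD; congr _%:E; lra.
- by move=> s; rewrite lee_fin.
- by move=> s; rewrite lee_fin sumr_ge0.
- by move=> k; exact: measurable_cst.
- exact: seq_measurable_sum.
Qed.

Lemma iexp_prod m (g : Z -> R) (e : R) : measurable_fun setT g ->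
  (forall z, 0 <= g z)%R -> \int[Q]_z (g z)%:E = e%:E ->
  iexp m (fun s => (\prod_(z <- s) g z)%:E) = (e ^+ m)%:E.
Proof.
move=> mg g0 gE; elim: m => [|m IH] /=; first by rewrite big_nil expr0.
have e0 : (0 <= e)%R by rewrite -lee_fin -gE; apply: integral_ge0 => z _; rewrite lee_fin.
transitivity (\int[Q]_z (0 + e ^+ m * g z + 0 * g z)%:E); last first.
  rewrite (integral_affine (eq := e) (ef := e))//; last by rewrite exprn_ge0.
  by congr _%:E; rewrite exprSr; lra.
apply: eq_integral => z _.
under [in LHS]eq_fun do rewrite big_cons EFinM.
rewrite iexpZ//.
- by rewrite IH -EFinM; congr _%:E; lra.
- by move=> s; rewrite lee_fin prodr_ge0.
- exact: seq_measurable_prod.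
Qed.

(** The product is a sum over ordered pairs of draws. The [m] diagonal pairs contribute [eq] each
    because [q * f = q]; the [m (m - 1)] others factor by independence. *)
Lemma iexp_sum_mul m (q f : Z -> R) (eq ef : R) :
  measurable_fun setT q -> measurable_fun setT f ->
  (forall z, 0 <= q z)%R -> (forall z, 0 <= f z)%R ->
  (forall z, q z * f z = q z)%R ->
  \int[Q]_z (q z)%:E = eq%:E -> \int[Q]_z (f z)%:E = ef%:E ->
  iexp m (fun s => ((\sum_(z <- s) q z) * (\sum_(z <- s) f z))%:E) =
    (m%:R * eq + m%:R * (m%:R - 1) * eq * ef)%:E.
Proof.
move=> mq mf q0 f0 qf qE fE; elim: m => [|m IH] /=; first by rewrite !big_nil !mul0r add0r.
have eq0 : (0 <= eq)%R by rewrite -lee_fin -qE; apply: integral_ge0 => z _; rewrite lee_fin.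
have ef0 : (0 <= ef)%R by rewrite -lee_fin -fE; apply: integral_ge0 => z _; rewrite lee_fin.
have S0 (g : Z -> R) s : (forall z, 0 <= g z)%R -> (0 <= \sum_(z <- s) g z)%R.
  by move=> g0; rewrite sumr_ge0.
have mS : seq_measurable (fun s => ((\sum_(z <- s) q z) * (\sum_(z <- s) f z))%:E).
  by apply: seq_measurable_mul; exact: seq_measurable_sum.
have mZ (c : R) (g : Z -> R) : measurable_fun setT g -> seq_measurable (fun s => c%:E * (\sum_(z <- s) g z)%:E).
  move=> mg k; apply: emeasurable_funM => //; exact: seq_measurable_sum.
(* The factor [m - 1] is taken in [R] and is negative at [m = 0], hence the case split. *)
have C0 : (0 <= m%:R * eq + m%:R * (m%:R - 1) * eq * ef)%R.
  case: m {IH} => [|m]; first by rewrite !mul0r add0r.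
  by rewrite addr_ge0 ?mulr_ge0// -natr1 addrK.
transitivity (\int[Q]_z ((m%:R * eq + m%:R * (m%:R - 1) * eq * ef) + (1 + m%:R * ef) * q z + (m%:R * eq) * f z)%:E); last first.
  rewrite (integral_affine (eq := eq) (ef := ef))//; try by rewrite ?addr_ge0 ?mulr_ge0.
  by congr _%:E; rewrite -natr1; ring.
apply: eq_integral => z _.
transitivity (iexp m (fun s => ((q z)%:E + (q z)%:E * (\sum_(x <- s) f x)%:E) +
  ((f z)%:E * (\sum_(x <- s) q x)%:E + ((\sum_(x <- s) q x) * (\sum_(x <- s) f x))%:E))).
  congr iexp; apply/funext => s; rewrite !big_cons -!EFinM -!EFinD; congr _%:E.
  by rewrite mulrDl !mulrDr qf; ring.
have mC (c : R) : seq_measurable (fun=> c%:E) by move=> k; exact: measurable_cst.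
have E0 (g : Z -> R) c s : (forall z, 0 <= g z)%R -> (0 <= c)%R ->
    0 <= c%:E * (\sum_(x <- s) g x)%:E.
  by move=> g0 c0; rewrite -EFinM lee_fin mulr_ge0// S0.
have EE0 s : 0 <= ((\sum_(x <- s) q x) * (\sum_(x <- s) f x))%:E.
  by rewrite lee_fin mulr_ge0// S0.
have q0E z' : 0 <= (q z')%:E by rewrite lee_fin.
rewrite !iexpD;
  try (by move=> s; first [exact: q0E | exact: E0 | exact: EE0 | apply: adde_ge0; first [exact: q0E | exact: E0 | exact: EE0]]);
  try (by first [exact: mC | exact: mZ | exact: mS]);
  try (by move=> k; apply: emeasurable_funD; first [exact: mC | exact: mZ | exact: mS]).
rewrite iexp_cst !iexpZ//; try (by move=> s; rewrite lee_fin S0); try exact: seq_measurable_sum.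
rewrite (iexp_sum m mf f0 fE) (iexp_sum m mq q0 qE) IH -!EFinM -!EFinD; congr _%:E; ring.
Qed.

End iterated_expectation.

(** * Real powers *)

Section power_facts.
Context (R : realType).
Implicit Types x y r : R.

Lemma powRN_le r x y : 0 <= r -> 0 < x -> x <= y -> y `^ (- r) <= x `^ (- r).
Proof.
move=> r0 x0 xy; have y0 := lt_le_trans x0 xy.
by rewrite !powRN lef_pV2 ?posrE ?powR_gt0// ge0_ler_powR// nnegrE ltW.
Qed.

Lemma powR_mulN x r : 0 < x -> x `^ r * x `^ (- r) = 1.
Proof. by move=> x0; rewrite powRN divff// gt_eqF// powR_gt0. Qed.

(** The expression equals [c^r m^(1-r)] and tends to 0; [x] is the value of [m] at which it would
    equal [e]. This controls the votes of points outside the neighbourhood where the mass bounds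
    hold. *)
Lemma powR_scale_vanish r c e : 1 < r -> 0 <= c -> 0 < e ->
  exists M : nat, forall m : nat, (M <= m)%N -> (0 < m)%N /\ m%:R * (c / m%:R) `^ r <= e.
Proof.
move=> r1 c0 e0; pose x := (c `^ r / e) `^ (r - 1)^-1.
have x0 : 0 <= x by exact: powR_ge0.
exists (Num.truncn x).+1 => m xm; have m0 : (0 < m)%N by apply: leq_trans xm.
have m0R : (0 : R) < m%:R by rewrite ltr0n.
split => //.
have xmR : x <= m%:R.
  by apply: le_trans (ltW (truncnS_gt x)) _; rewrite ler_nat.
have h : c `^ r / e <= m%:R `^ (r - 1).
  apply: (@le_trans _ _ (x `^ (r - 1))).
    rewrite /x -powRrM mulVf; last by rewrite subr_eq0 gt_eqF.
    by rewrite powRr1// divr_ge0 ?powR_ge0 ?ltW.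
  by rewrite ge0_ler_powR// ?nnegrE ?ltW// subr_gt0.
rewrite powRM ?invr_ge0 ?(ltW m0R)//.
rewrite -powR_inv1 ?(ltW m0R)// -powRrM mulN1r powRN.
rewrite -(@mulr_powRB1 _ m%:R r) ?(ltW m0R)//; last by rewrite (lt_trans _ r1).
have p0 : 0 < m%:R `^ (r - 1) by rewrite powR_gt0.
have -> : m%:R * (c `^ r * (m%:R * m%:R `^ (r - 1))^-1) = c `^ r / m%:R `^ (r - 1).
  by field; rewrite !gt_eqF.
by rewrite ler_pdivrMr// -ler_pdivrMl// mulrC.
Qed.

End power_facts.

Lemma le_sum_mem (R : numDomainType) (I : eqType) (s : seq I) (F : I -> R) j :
  j \in s -> (forall i, i \in s -> 0 <= F i) -> F j <= \sum_(i <- s) F i.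
Proof.
move=> js F0; rewrite (big_rem j)//= lerDl big_seq_cond sumr_ge0// => i.
by rewrite andbT => /mem_rem; exact: F0.
Qed.

(** * Votes and truncated moments around a fixed query point *)

Section abstract_interpolator.
Context d (Z : measurableType d) (R : realType).
Variable Q : {sigma_finite_measure set Z -> \bar R}.
Hypothesis Q1 : Q setT = 1%E.
Variables (w sg : Z -> R) (r : R).
Hypotheses (mw : measurable_fun setT w) (msg : measurable_fun setT sg).
Hypotheses (w0 : forall z, 0 <= w z) (sgE : forall z, sg z = 1 \/ sg z = -1).
Hypothesis r1 : 1 < r.

(** By the convention for powers of 0, a draw with [w z = 0] has weight 0. *)
Definition wpow (z : Z) : R := w z `^ (- r).
Definition shell (a b : R) : set Z := [set z | a < w z <= b].
(** In the application [sg] is the label of the draw times the true label at the query point, so a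
    nonpositive score means a wrong prediction. *)
Definition score (s : seq Z) : R := \sum_(z <- s) sg z * wpow z.
Definition flipped : set Z := [set z | sg z = -1].
(** Twice the sum of the geometric series with ratio [2^(1-r)], which arises from dyadic shells. *)
Definition geom : R := 2 / (1 - 2 `^ (1 - r)).

(* [penal N tau b s1] bounds the weight of the points of [N] relative to that of
   a point at distance [tau]: points closer than [b] count for 1, and points
   farther than [s1] are counted regardless of [N]. *)
Definition penal (N : set Z) (tau b s1 : R) (z : Z) : R :=
  \1_(N `&` shell 0 b) z + tau `^ r * (\1_(N `&` shell b s1) z * wpow z)
  + tau `^ r * s1 `^ (- r) * \1_[set z | s1 < w z] z.

Lemma r_ge0 : 0 <= r. Proof. by rewrite ltW// (lt_trans _ r1). Qed.

Lemma wpow_ge0 z : 0 <= wpow z. Proof. exact: powR_ge0. Qed.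

Lemma wpow_eq0 z : w z = 0 -> wpow z = 0.
Proof. by move=> wz; rewrite /wpow wz powR0// oppr_eq0 gt_eqF// (lt_trans _ r1). Qed.

Lemma measurable_shell a b : measurable (shell a b).
Proof.
rewrite (_ : shell a b = w @^-1` `]a, b]%classic); last first.
  by apply/seteqP; split=> z; rewrite /shell/= in_itv.
by rewrite -[X in measurable X]setTI; exact: (mw measurableT (measurable_itv _)).
Qed.

Lemma measurable_far a : measurable [set z | a < w z].
Proof.
rewrite (_ : [set z | a < w z] = w @^-1` `]a, +oo[%classic); last first.
  by apply/seteqP; split=> z; rewrite /= in_itv/= andbT.
by rewrite -[X in measurable X]setTI; exact: (mw measurableT (measurable_itv _)).
Qed.

Lemma measurable_flipped : measurable flipped.
Proof. by rewrite -[X in measurable X]setTI; exact: (msg measurableT (measurable_set1 (-1))). Qed.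

Lemma measurable_wpow : measurable_fun setT wpow.
Proof. exact: (measurableT_comp (@measurable_powR R (- r)) mw). Qed.

Lemma geom_gt0 : 0 < geom /\ geom * 2 `^ (1 - r) + 2 = geom.
Proof.
have : 2 `^ (1 - r) < (1 : R).
  rewrite /powR pnatr_eq0/= -[ltRHS]expR0 ltr_expR nmulr_rlt0 ?subr_lt0//.
  by rewrite ln_gt0// ltr1n.
set y := 2 `^ (1 - r) => y1; have y2 : 0 < 1 - y by rewrite subr_gt0.
split; first by rewrite /geom -/y divr_gt0.
by rewrite /geom -/y; field; rewrite gt_eqF.
Qed.

Lemma indic_ge0 (A : set Z) z : 0 <= (\1_A z : R).
Proof. by rewrite indicE. Qed.
Hint Resolve indic_ge0 wpow_ge0 : core.

(** Dyadic decomposition: the part of [N] with [b < w <= 2 b] has mass at most [2 A b] and weights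
    at most [b^-r], and the remainder is the same problem with [2 b] for [b]. *)
Lemma truncated_moment (N : set Z) (A s1 b : R) : measurable N -> 0 <= A -> 0 < b ->
  (forall s, 0 < s -> s <= s1 -> (Q (N `&` shell 0 s) <= (A * s)%:E)%E) ->
  (\int[Q]_z (\1_(N `&` shell b s1) z * wpow z)%:E <= (A * geom * b `^ (1 - r))%:E)%E.
Proof.
move=> mN A0 b0 AN; have [g0 gE] := geom_gt0.
(* [K] doublings carry [b] at least to [s1]; the induction is on [K], with [b] varying. *)
have [K sK] : exists K : nat, s1 <= b * 2 ^+ K.
  exists (Num.truncn (s1 / b)).+1; rewrite mulrC -ler_pdivrMr//.
  apply: le_trans (ltW (truncnS_gt _)) _.
  by rewrite -natrX ler_nat ltnW// ltn_expl.
have mI B : measurable B -> measurable_fun setT (\1_B : Z -> R).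
  by move=> mB; exact: measurable_indic.
have mNs a c : measurable (N `&` shell a c).
  by apply: measurableI => //; exact: measurable_shell.
elim: K b b0 sK => [|K IH] b b0 sK.
  rewrite integral0_eq; last first.
    move=> z _; rewrite indicE memNset ?mul0r// => -[_ /andP[h1 h2]].
    by move: sK; rewrite expr0 mulr1 leNgt (lt_le_trans h1 h2).
  by rewrite lee_fin mulr_ge0 ?powR_ge0// mulr_ge0// ltW.
have [s10|s10] := leP s1 0.
  rewrite integral0_eq; last first.
    move=> z _; rewrite indicE memNset ?mul0r// => -[_ /andP[h1 h2]].
    by move: (lt_le_trans b0 (ltW (lt_le_trans h1 h2))); rewrite ltNge s10.
  by rewrite lee_fin mulr_ge0 ?powR_ge0// mulr_ge0// ltW.
(* The minimum keeps the radius in the range where the mass bound [AN] applies. *)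
pose c := Order.min (2 * b) s1.
have c0 : 0 < c by rewrite lt_min s10 mulr_gt0.
pose F z : \bar R := ((b `^ (- r))%:E * (\1_(N `&` shell 0 c) z)%:E +
    (\1_(N `&` shell (2 * b) s1) z * wpow z)%:E)%E.
apply: (@le_trans _ _ (\int[Q]_z F z)%E); rewrite /F.
  apply: ge0_le_integral_any => z; first by rewrite lee_fin mulr_ge0.
  rewrite -EFinM -EFinD lee_fin.
  have [zN|zN] := boolP (z \in N `&` shell b s1); last first.
    by rewrite indicE (negbTE zN) mul0r addr_ge0 ?mulr_ge0 ?powR_ge0.
  move: (zN); rewrite inE => -[Nz /andP[bz zs]].
  have [z2|z2] := ltP (2 * b) (w z).
    rewrite [X in _ <= _ + X * _]indicE mem_set ?[X in X * _]indicE ?zN//; last first.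
      by split => //; rewrite /shell/= z2.
    by rewrite mul1r lerDr mulr_ge0 ?powR_ge0.
  rewrite [X in _ <= _ * X + _]indicE mem_set; last first.
    by split => //; rewrite /shell/= (lt_trans b0 bz) le_min z2.
  rewrite indicE zN mul1r mulr1 (_ : wpow z <= _)//.
  apply: le_trans (_ : b `^ (- r) <= _); last by rewrite lerDl mulr_ge0.
  by rewrite /wpow powRN_le ?r_ge0 ?ltW.
rewrite ge0_integralD//; last 4 first.
- by move=> z _; rewrite -EFinM lee_fin mulr_ge0 ?powR_ge0.
- by apply: emeasurable_funM => //; apply/measurable_EFinP; exact: mI.
- by move=> z _; rewrite lee_fin mulr_ge0.
- by apply/measurable_EFinP; apply: measurable_funM; [exact: mI|exact: measurable_wpow].
rewrite ge0_integralZl_EFin ?powR_ge0//; last by apply/measurable_EFinP; exact: mI.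
rewrite integral_indic// setIT.
have b20 : 0 < 2 * b by rewrite mulr_gt0.
have s2K : s1 <= 2 * b * 2 ^+ K by rewrite mulrAC -exprS mulrC.
apply: le_trans (leeD _ (IH _ b20 s2K)) _.
  apply: lee_wpmul2l; first by rewrite lee_fin powR_ge0.
  by apply: (AN c) => //; rewrite /c ge_min lexx orbT.
rewrite -EFinM -EFinD lee_fin powRM ?(ltW b0)//.
apply: (@le_trans _ _ (b `^ (- r) * (A * (2 * b)) + A * geom * (2 `^ (1 - r) * b `^ (1 - r)))).
  rewrite lerD2r ler_wpM2l ?powR_ge0// ler_wpM2l// /c ge_min lexx//.
have -> : b `^ (1 - r) = b * b `^ (- r).
  by rewrite powRD ?powRr1 ?(ltW b0)// (gt_eqF b0) implybT.
(* The fixed-point equation [geom * 2^(1-r) + 2 = geom] closes the recursion exactly. *)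
rewrite -[in leRHS]gE le_eqVlt; apply/orP; left; apply/eqP; ring.
Qed.

Lemma penal_ge0 N tau b s1 z : 0 <= penal N tau b s1 z.
Proof. by rewrite /penal !addr_ge0 ?mulr_ge0 ?powR_ge0. Qed.

Lemma measurable_penal N tau b s1 : measurable N -> measurable_fun setT (penal N tau b s1).
Proof.
move=> mN; apply: measurable_funD; first apply: measurable_funD.
- by apply: measurable_indic; apply: measurableI => //; exact: measurable_shell.
- apply: measurable_funM => //; apply: measurable_funM; last exact: measurable_wpow.
  by apply: measurable_indic; apply: measurableI => //; exact: measurable_shell.
- apply: measurable_funM => //; apply: measurable_indic; exact: measurable_far.
Qed.

(** The three terms come from the mass of the inner shell, the truncated moment and the total mass
    1. The integral is named as a real number [e] so that the formulas for sample expectations apply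
    to it. *)
Lemma integral_penal (N : set Z) (A s1 b tau : R) : measurable N -> 0 <= A ->
  0 < b -> b <= s1 -> 
  (forall s, 0 < s -> s <= s1 -> (Q (N `&` shell 0 s) <= (A * s)%:E)%E) ->
  exists2 e : R, (\int[Q]_z (penal N tau b s1 z)%:E = e%:E)%E &
    0 <= e <= A * b + tau `^ r * (A * geom * b `^ (1 - r)) + tau `^ r * s1 `^ (- r).
Proof.
move=> mN A0 b0 bs1 AN.
suff h : (0 <= \int[Q]_z (penal N tau b s1 z)%:E <=
    (A * b + tau `^ r * (A * geom * b `^ (1 - r)) + tau `^ r * s1 `^ (- r))%:E)%E.
  move: h => /andP[h1 h2].
  have hf : (\int[Q]_z (penal N tau b s1 z)%:E)%E \is a fin_num.
    by rewrite ge0_fin_numE// (le_lt_trans h2) ?ltry.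
  exists (fine (\int[Q]_z (penal N tau b s1 z)%:E)%E); first by rewrite fineK.
  by rewrite -!lee_fin fineK// h1 h2.
apply/andP; split; first by apply: integral_ge0 => z _; rewrite lee_fin penal_ge0.
have mNs a c : measurable (N `&` shell a c).
  by apply: measurableI => //; exact: measurable_shell.
have mI B : measurable B -> measurable_fun setT (EFin \o (\1_B : Z -> R)).
  by move=> mB; apply/measurable_EFinP; exact: measurable_indic.
have mB : measurable_fun setT (fun z => (\1_(N `&` shell b s1) z * wpow z)%:E).
  apply/measurable_EFinP; apply: measurable_funM; last exact: measurable_wpow.
  exact: measurable_indic.
have t0 : 0 <= tau `^ r by exact: powR_ge0.
have ts0 : 0 <= tau `^ r * s1 `^ (- r) by rewrite mulr_ge0 ?powR_ge0.
rewrite /penal; under eq_integral do rewrite !EFinD [X in (_ + X + _)%E]EFinM [X in (_ + X)%E]EFinM.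
rewrite ge0_integralD//; last 4 first.
- by move=> z _; rewrite -EFinM -EFinD lee_fin !addr_ge0// !mulr_ge0.
- by apply: emeasurable_funD; [exact: mI|exact: emeasurable_funM].
- by move=> z _; rewrite -EFinM lee_fin mulr_ge0.
- by apply: emeasurable_funM => //; apply: mI; exact: measurable_far.
rewrite ge0_integralD//; last 3 first.
- exact: mI.
- by move=> z _; rewrite -EFinM lee_fin !mulr_ge0.
- exact: emeasurable_funM.
rewrite !ge0_integralZl_EFin//; last 2 first.
- by apply: mI; exact: measurable_far.
- by move=> z _; rewrite lee_fin mulr_ge0.
rewrite !integral_indic//; last exact: measurable_far.
rewrite !setIT !EFinD; apply: leeD; first apply: leeD.
- exact: AN.
- by rewrite EFinM; apply: lee_wpmul2l => //; exact: truncated_moment.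
- rewrite -[leRHS]mule1; apply: lee_wpmul2l => //.
  by rewrite -Q1; apply: le_measure => //; rewrite inE; [exact: measurable_far|exact: measurableT].
Qed.

End abstract_interpolator.

(** * Deterministic inequalities for a single sample *)

Section interpolation_inequalities.
Context d (Z : measurableType d) (R : realType).
Variables (w sg : Z -> R) (r : R).
Hypotheses (w0 : forall z, 0 <= w z) (sgE : forall z, sg z = 1 \/ sg z = -1).
Hypothesis r1 : 1 < r.

Let rge0 : 0 <= r. Proof. by rewrite ltW// (lt_trans _ r1). Qed.
Let v0 z : 0 <= wpow w r z. Proof. exact: wpow_ge0. Qed.
Let sh := shell w.
Let i0 (A : set Z) z : 0 <= (\1_A z : R). Proof. by rewrite indicE. Qed.

Lemma penal_near (N : set Z) (tau b s1 : R) z : b <= s1 -> N z -> sh 0 b z ->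
  penal w r N tau b s1 z = 1.
Proof.
move=> bs1 Nz bz; have /andP[_ wb] := bz.
rewrite /penal indicE mem_set; last by split.
rewrite indicE memNset; last by move=> [_ /andP[]]; rewrite ltNge wb.
rewrite indicE memNset; last by rewrite /= ltNge (le_trans wb bs1).
by rewrite mul0r !mulr0 !addr0.
Qed.

(** Beyond [s1] the weight is at most [s1^-r]; between [b] and [s1] the penalty contains the weight
    itself; at [w z = 0] the weight is 0. *)
Lemma penal_dominates (N : set Z) (tau b s1 : R) z : 0 < b -> b <= s1 ->
  (w z <= s1 -> N z) -> ~ (N z /\ sh 0 b z) ->
  tau `^ r * wpow w r z <= penal w r N tau b s1 z.
Proof.
move=> b0 bs1 Nz nz.
have t0 : 0 <= tau `^ r by exact: powR_ge0.
have [ws|sw] := leP (w z) s1; last first.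
  rewrite /penal [X in _ + _ * X]indicE mem_set//= mulr1.
  apply: le_trans (_ : tau `^ r * s1 `^ (- r) <= _); last first.
    by rewrite lerDr addr_ge0// !mulr_ge0.
  by rewrite ler_wpM2l// /wpow powRN_le// ?ltW// (lt_le_trans b0).
have [wb|bw] := leP (w z) b.
  have [wz0|wz0] := leP (w z) 0.
    by rewrite wpow_eq0 ?mulr0 ?penal_ge0//; apply/le_anti/andP.
  by exfalso; apply: nz; split; [exact: Nz|rewrite /sh /shell/= wz0].
rewrite /penal [X in _ + _ * (X * _) + _]indicE mem_set; last first.
  by split; [exact: Nz|rewrite /shell/= bw].
by rewrite /= mul1r addrAC lerDr addr_ge0// mulr_ge0// ?mulr_ge0 ?powR_ge0.
Qed.

Lemma rel_weight_ge1 (tau : R) z : 0 < tau -> sh 0 tau z -> 1 <= tau `^ r * wpow w r z.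
Proof.
move=> t0 /andP[wz0 wt]; rewrite -(powR_mulN r wz0) /wpow.
by rewrite ler_wpM2r ?powR_ge0// ge0_ler_powR// nnegrE ltW.
Qed.

(** If no draw lies within [tau], the product is 1. If a flipped draw lies within [b], its penalty
    is 1. Otherwise some correct draw lies within [tau], and a nonpositive score forces the flipped
    draws to outweigh it. *)
Lemma error_le_penalties (tau b s1 : R) (s : seq Z) : 0 < tau -> tau <= b -> b <= s1 ->
  score w sg r s <= 0 ->
  1 <= \prod_(z <- s) \1_(~` sh 0 tau) z + \sum_(z <- s) penal w r (flipped sg) tau b s1 z.
Proof.
move=> t0 tb bs1 sc; have b0 := lt_le_trans t0 tb.
set P := \prod_(z <- s) _; set S := \sum_(z <- s) _.
have P0 : 0 <= P by apply: prodr_ge0 => z _.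
have S0 : 0 <= S by apply: sumr_ge0 => z _; exact: penal_ge0.
have [/hasP[j js /asboolP jt]|hn] := boolP (has (fun z => `[< sh 0 tau z >]) s); last first.
  suff -> : P = 1 by rewrite lerDl.
  rewrite /P big_seq big1// => z zs; rewrite indicE mem_set// => zt.
  by move/hasPn : hn => /(_ z zs) /asboolP.
have [/hasP[i is_ /asboolP [iN ib]]|hn] := boolP (has (fun z => `[< flipped sg z /\ sh 0 b z >]) s).
  suff : 1 <= S by move=> S1; rewrite (le_trans S1)// lerDr.
  rewrite -(penal_near tau bs1 iN ib); apply: le_sum_mem => // z _; exact: penal_ge0.
have nb z : z \in s -> ~ (flipped sg z /\ sh 0 b z).
  by move=> zs h; move/hasPn : hn => /(_ z zs) /asboolP; exact.
suff : 1 <= S by move=> S1; rewrite (le_trans S1)// lerDr.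
have jb : sh 0 b j by move: jt => /andP[j0 jt]; rewrite /sh /shell/= j0 (le_trans jt).
have sj : sg j = 1 by case: (sgE j) => // h; exfalso; apply: (nb j js); split.
have tr0 : 0 <= tau `^ r by exact: powR_ge0.
(* Relative vote plus penalty is nonnegative for every draw and at least 1 for [j]; as the votes sum
   to at most 0, the penalties sum to at least 1. *)
pose F z := tau `^ r * (sg z * wpow w r z) + penal w r (flipped sg) tau b s1 z.
have F0 z : z \in s -> 0 <= F z.
  move=> zs; rewrite /F; case: (sgE z) => h; rewrite h.
    by rewrite mul1r addr_ge0 ?penal_ge0// mulr_ge0.
  by rewrite mulN1r mulrN addrC subr_ge0 penal_dominates//; exact: nb.
have : 1 <= F j.
  rewrite /F sj mul1r (le_trans (rel_weight_ge1 t0 jt))// lerDl penal_ge0//.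
move=> /le_trans -/(_ _ (le_sum_mem js F0)) /le_trans; apply.
by rewrite /F big_split/= -mulr_sumr gerDr mulr_ge0_le0.
Qed.

(** With [n] near flipped draws and total penalty [Phi], the claim bounds [n (2 - Phi)] by the error
    indicator, and the expectation of this quantity involves only single draws and pairs. If
    [Phi < 2] and [n > 0], a near flipped draw already accounts for 1 in [Phi], so the others
    together weigh less than it does. *)
Lemma penalties_le_error (al b s1 : R) (s : seq Z) : 0 < al -> al <= b -> b <= s1 ->
  2 * (\sum_(z <- s) \1_(flipped sg `&` sh 0 al) z) <=
  (if score w sg r s < 0 then 1 else 0) +
  (\sum_(z <- s) \1_(flipped sg `&` sh 0 al) z) *
  (\sum_(z <- s) penal w r setT al b s1 z) :> R.
Proof.
move=> a0 ab bs1; set n := \sum_(z <- s) \1_ _ _; set Phi := \sum_(z <- s) penal _ _ _ _ _ _ _.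
have b0 := lt_le_trans a0 ab.
pose phi z := penal w r setT al b s1 z.
have phi0 z : 0 <= phi z by exact: penal_ge0.
have e0 : 0 <= (if score w sg r s < 0 then 1 else 0) :> R by case: ifP.
have n0 : 0 <= n by apply: sumr_ge0.
have [Phi2|Phi2] := leP 2 Phi.
  by rewrite (le_trans (_ : _ <= n * Phi))// ?lerDr// mulrC ler_wpM2l.
have alb z : sh 0 al z -> sh 0 b z.
  by move=> /andP[z0 za]; rewrite /sh /shell/= z0 (le_trans za).
have [/hasP[j js /asboolP [jN ja]]|hn] :=
    boolP (has (fun z => `[< flipped sg z /\ sh 0 al z >]) s); last first.
  have -> : n = 0.
    rewrite /n big_seq big1// => z zs; rewrite indicE memNset// => zt.
    by move/hasPn : hn => /(_ z zs) /asboolP.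
  by rewrite mulr0 mul0r addr0.
have phij : phi j = 1 by apply: penal_near => //; exact: alb.
have PhiE : Phi = 1 + \sum_(z <- rem j s) phi z.
  by rewrite /Phi (big_rem j)//= -/(phi j) phij.
have Phi1 : \sum_(z <- rem j s) phi z < 1 by move: Phi2; rewrite PhiE; lra.
have far z : z \in rem j s -> ~ sh 0 b z.
  move=> zs zb; move: Phi1; rewrite ltNge => /negP; apply.
  have <- : phi z = 1 by exact: penal_near.
  exact: (le_sum_mem (F := phi) zs).
have nE : n = 1.
  rewrite /n (big_rem j)//= indicE mem_set//= big_seq big1 ?addr0// => z zs.
  by rewrite indicE memNset// => -[_ /alb]; exact: far.
have sc : score w sg r s < 0.
  have t0 : 0 < al `^ r by rewrite powR_gt0.
  (* After scaling by [al^r] the vote of [j] has size at least 1, while the other votes are bounded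
     by penalties whose sum is below 1. *)
  rewrite -(pmulr_rlt0 _ t0) /score (big_rem j)//= mulrDr jN mulN1r mulrN addrC subr_lt0.
  apply: lt_le_trans (rel_weight_ge1 a0 ja).
  apply: le_lt_trans Phi1.
  rewrite mulr_sumr big_seq [leRHS]big_seq; apply: ler_sum => z zs.
  apply: le_trans (_ : al `^ r * wpow w r z <= _).
    rewrite ler_wpM2l ?(ltW t0)//; case: (sgE z) => ->; first by rewrite mul1r.
    by rewrite mulN1r (le_trans _ (v0 z))// oppr_le0.
  by apply: penal_dominates => // -[_]; exact: far.
have S0 : 0 <= \sum_(z <- rem j s) phi z by apply: sumr_ge0.
(* With [n = 1] and an error present, the claim reads [2 <= 1 + Phi]. *)
by rewrite sc nE PhiE; move: S0; lra.
Qed.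

End interpolation_inequalities.

(** * Error probability at a fixed query point *)

Section interpolation_bounds.
Context d (Z : measurableType d) (R : realType).
Variable Q : {sigma_finite_measure set Z -> \bar R}.
Hypothesis Q1 : Q setT = 1%E.
Variables (w sg : Z -> R) (r : R).
Hypotheses (mw : measurable_fun setT w) (msg : measurable_fun setT sg).
Hypotheses (w0 : forall z, 0 <= w z) (sgE : forall z, sg z = 1 \/ sg z = -1).
Hypothesis r1 : 1 < r.
Variables (p ka s1 : R).
Hypotheses (p0 : 0 < p) (p49 : p < 49 / 100) (ka0 : 0 < ka) (s10 : 0 < s1).
Hypothesis Qub : forall s, 0 < s -> s <= s1 -> (Q (shell w 0 s) <= (2 * ka * s)%:E)%E.
Hypothesis Qlb : forall s, 0 < s -> s <= s1 -> ((ka * s / 2)%:E <= Q (shell w 0 s))%E.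
Hypothesis Qflip : forall s, 0 < s -> s <= s1 ->
  (Q (flipped sg `&` shell w 0 s) = p%:E * Q (shell w 0 s))%E.

(** The power of 2 comes from [T = 2 ln (1/p)], raised to the same exponent as the logarithm; the
    second factor collects the bounds on the error events, using [B >= 1]. *)
Definition upper_const : R := 2 `^ (1 / (1 - r^-1)) * (4 + 2 * geom r).
(* Small enough for the expected penalties in the lower bound to sum to 1/2. *)
Definition lower_width : R := (8 + 16 * geom r * 8 `^ (r - 1))^-1.
Definition lower_const : R := lower_width / 4.

Let measurable_sgwpow : measurable_fun setT (fun z => sg z * wpow w r z).
Proof. by apply: measurable_funM => //; exact: measurable_wpow. Qed.

Lemma integral_indicE (A : set Z) (q : R) : measurable A -> Q A = q%:E ->
  (\int[Q]_z (\1_A z)%:E = q%:E)%E.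
Proof. by move=> mA QA; rewrite integral_indic// setIT. Qed.

(** Expectation of [error_le_penalties] with radii [T / (ka m)] and [B / (ka m)]: the product
    factors by independence and the penalties add up. *)
Lemma interpolation_upper : exists M : nat, forall m, (M <= m)%N ->
  (iexp Q m (fun s => (if score w sg r s <= 0 then 1 else 0)%:E) <=
   (upper_const * (ln (1 / p)) `^ (1 / (1 - r^-1)) * p)%:E)%E.
Proof.
have r0 : 0 < r by rewrite (lt_trans _ r1).
have [g0 _] := geom_gt0 r1.
pose L := ln (1 / p); pose a := 1 / (1 - r^-1); pose T := 2 * L.
have aE : a = r / (r - 1).
  by rewrite /a; field; rewrite ?gt_eqF ?subr_gt0.
have LE : L = - ln p by rewrite /L div1r lnV.
(* From [ln p <= p - 1] and [p < 0.49]; it gives [T >= 1], which is what orders the powers of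
   [T]. *)
have L1 : 51 / 100 <= L.
  have : ln (1 + (p - 1)) <= p - 1 by apply: le_ln1Dx; move: p0; lra.
  rewrite [X in ln X](_ : _ = p); last by ring.
  by rewrite LE; move: p49; lra.
have T1 : 1 <= T by rewrite /T; lra.
have T0 : 0 < T by lra.
(* Chosen so that [B^(1-r) = T^-r]: the votes from beyond [b] then cost only a constant times
   [p]. *)
pose B := T `^ a.
have a1 : 1 <= a by rewrite aE ler_pdivlMr ?subr_gt0// mul1r; lra.
have TB : T <= B by exact: le1r_powR.
have B0 : 0 < B by lra.
have BT : B `^ (1 - r) = T `^ (- r).
  rewrite /B -powRrM; congr (_ `^ _); rewrite aE; field.
  by rewrite gt_eqF// subr_gt0.
(* [M1] makes the expected penalty from beyond [s1] at most [p]; the second threshold below ensures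
   [b <= s1]. *)
have sp : 0 < p / s1 `^ (- r) by rewrite divr_gt0// powR_gt0.
have [M1 M1P] := powR_scale_vanish r1 (ltW (divr_gt0 T0 ka0)) sp.
exists (maxn M1 (Num.truncn (B / (ka * s1))).+1) => m.
rewrite geq_max => /andP[/M1P[m0 mv] mB].
have m0R : 0 < m%:R :> R by rewrite ltr0n.
pose b := B / (ka * m%:R); pose tau := T / (ka * m%:R).
have km0 : 0 < ka * m%:R by rewrite mulr_gt0.
have b0 : 0 < b by rewrite divr_gt0.
have tau0 : 0 < tau by rewrite divr_gt0.
have tb : tau <= b by rewrite ler_pM2r ?invr_gt0.
have bs1 : b <= s1.
  have : B / (ka * s1) <= m%:R.
    by apply: le_trans (ltW (truncnS_gt _)) _; rewrite ler_nat.
  by rewrite !ler_pdivrMr ?mulr_gt0// => h; rewrite (_ : s1 * (ka * m%:R) = m%:R * (ka * s1))//; ring.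
have ts1 := le_trans tb bs1.
have mflip := measurable_flipped msg.
have msh a' c := measurable_shell mw a' c.
have Afl s : 0 < s -> s <= s1 -> (Q (flipped sg `&` shell w 0 s) <= ((2 * ka * p) * s)%:E)%E.
  move=> s0 ss; rewrite Qflip//; apply: le_trans (lee_wpmul2l _ (Qub s0 ss)) _.
    by rewrite lee_fin ltW.
  by rewrite -EFinM lee_fin le_eqVlt; apply/orP; left; apply/eqP; ring.
have A0 : 0 <= 2 * ka * p by rewrite !mulr_ge0 ?ltW.
have [e2 e2E /andP[e20 e2le]] := integral_penal Q1 mw r1 tau mflip A0 b0 bs1 Afl.
have [q1 q1E] : exists q : R, Q (shell w 0 tau) = q%:E.
  exists (fine (Q (shell w 0 tau))); rewrite fineK// ge0_fin_numE//.
  by rewrite (le_lt_trans (Qub tau0 ts1))// ltry.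
have q1le1 : q1 <= 1.
  rewrite -lee_fin -q1E -Q1; apply: le_measure => //; rewrite inE; [exact: msh|exact: measurableT].
have q1lb : ka * tau / 2 <= q1 by rewrite -lee_fin -q1E Qlb.
pose e1 := 1 - q1.
have mC : measurable (~` shell w 0 tau) by apply: measurableC.
have QC : Q (~` shell w 0 tau) = e1%:E.
  rewrite -setTD measureD ?setTI//; first by rewrite [X in (X - _)%E]Q1 [X in (_ - X)%E]q1E.
  by rewrite [X in (X < _)%E]Q1 ltry.
have e10 : 0 <= e1 by rewrite subr_ge0.
(* [(1 - q1)^m <= exp (- m ka tau / 2) = exp (- T / 2) = p]. The factor 2 in [T] compensates the one
   lost in the lower mass bound. *)
have e1p : e1 ^+ m <= p.
  apply: (@le_trans _ _ (expR (- (ka * tau / 2)) ^+ m)).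
    rewrite lerXn2r ?nnegrE ?expR_ge0//.
    by apply: le_trans (expR_ge1Dx _); rewrite /e1; lra.
  rewrite -expRM_natl (_ : _ * _ = - L).
    by rewrite LE opprK lnK.
  by rewrite /tau /T; field; rewrite ?gt_eqF.
pose F1 s : R := \prod_(z <- s) \1_(~` shell w 0 tau) z.
pose F2 s : R := \sum_(z <- s) penal w r (flipped sg) tau b s1 z.
have F10 s : 0 <= F1 s by apply: prodr_ge0 => z _; rewrite indicE.
have F20 s : 0 <= F2 s by apply: sumr_ge0 => z _; exact: penal_ge0.
apply: (@le_trans _ _ (iexp Q m (fun s => (F1 s)%:E + (F2 s)%:E)%E)).
  apply: le_iexp => s; first by case: ifP.
  rewrite -EFinD lee_fin; case: ifP => [sc|_]; last exact: addr_ge0.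
  exact: error_le_penalties.
rewrite iexpD; last 4 first.
- by move=> s; rewrite lee_fin.
- by move=> s; rewrite lee_fin.
- by apply: seq_measurable_prod; exact: measurable_indic.
- by apply: seq_measurable_sum; exact: measurable_penal.
have iF1 : iexp Q m (fun s => (F1 s)%:E) = (e1 ^+ m)%:E.
  apply: iexp_prod => //; exact: integral_indicE.
have iF2 : iexp Q m (fun s => (F2 s)%:E) = (m%:R * e2)%:E.
  by apply: iexp_sum => // [|z]; [exact: measurable_penal|exact: penal_ge0].
rewrite iF1 iF2.
rewrite -EFinD lee_fin.
have TL : T `^ a = 2 `^ a * L `^ a by rewrite /T powRM//; lra.
have Ta1 : 1 <= T `^ a by apply: le_trans TB.
(* [far], [near] and [mid] evaluate the three terms of the bound on [m * e2]. *)
have far : m%:R * (tau `^ r * s1 `^ (- r)) <= p.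
  by rewrite mulrA -ler_pdivlMr ?powR_gt0//; move: mv; rewrite /tau -mulrA -invfM.
have near : m%:R * (2 * ka * p * b) = 2 * B * p.
  by rewrite /b; field; rewrite !gt_eqF.
have mid : m%:R * (tau `^ r * (2 * ka * p * geom r * b `^ (1 - r))) = 2 * geom r * p.
  have ki0 : 0 < (ka * m%:R)^-1 by rewrite invr_gt0.
  have kE : m%:R * ka * (ka * m%:R)^-1 = 1 by rewrite [m%:R * ka]mulrC divff ?gt_eqF.
  rewrite /b /tau (powRM r (ltW T0) (ltW ki0)) (powRM (1 - r) (ltW B0) (ltW ki0)) BT.
  have -> : (ka * m%:R)^-1 `^ (1 - r) = (ka * m%:R)^-1 * ((ka * m%:R)^-1) `^ (- r).
    by rewrite powRD ?powRr1 ?(ltW ki0)// (gt_eqF ki0) implybT.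
  have hk := powR_mulN r ki0; have hT := powR_mulN r T0.
  move: hk hT kE; set k := (ka * m%:R)^-1; set x := k `^ r; set y := k `^ (- r).
  set u := T `^ r; set t := T `^ (- r) => hk hT kE.
  have -> : m%:R * (u * x * (2 * ka * p * geom r * (t * (k * y)))) =
    2 * geom r * p * (u * t) * (x * y) * (m%:R * ka * k) by ring.
  by rewrite hk hT kE !mulr1.
apply: (@le_trans _ _ (p + (2 * B * p + 2 * geom r * p + p))).
  rewrite lerD// -near -mid; apply: le_trans (ler_wpM2l (ltW m0R) e2le) _.
  by rewrite !mulrDr lerD2l.
rewrite /upper_const -/a -/L.
have -> : 2 `^ a * (4 + 2 * geom r) * L `^ a = B * (4 + 2 * geom r).
  by rewrite /B TL; ring.
have -> : p + (2 * B * p + 2 * geom r * p + p) = (2 + 2 * B + 2 * geom r) * p by ring.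
rewrite ler_wpM2r ?(ltW p0)//.
(* [B >= 1] absorbs the constant terms into the multiple of [B]. *)
have : 1 * (2 * geom r + 2) <= B * (2 * geom r + 2) by rewrite ler_wpM2r//; lra.
lra.
Qed.

(** In expectation [penalties_le_error] bounds the error probability below by
    [m e (1 - (m - 1) ef)], where [e] is the mass of near flipped draws and [ef] the mean penalty.
    The radii make [m ef <= 1/2] and [m e >= p a / 2]. *)
Lemma interpolation_lower : exists M : nat, forall m, (M <= m)%N ->
  ((lower_const * p)%:E <=
   iexp Q m (fun s => (if score w sg r s < 0 then 1 else 0)%:E))%E.
Proof.
have r0 : 0 < r by rewrite (lt_trans _ r1).
have [g0 _] := geom_gt0 r1.
pose a := lower_width.
have E8 : 0 < 8 `^ (r - 1) :> R by rewrite powR_gt0.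
have D0 : 0 < 8 + 16 * geom r * 8 `^ (r - 1) by rewrite addr_gt0// mulr_gt0// mulr_gt0.
have a0 : 0 < a by rewrite invr_gt0.
have a8 : a <= 1 / 8.
  by rewrite /a /lower_width div1r lef_pV2 ?posrE// lerDl mulr_ge0 ?(ltW E8)// mulr_ge0// ltW.
(* Since [a <= 1] and [r > 1], [a^r <= a]; the denominator of [lower_width] does the rest. *)
have ag : a `^ r * (2 * geom r * 8 `^ (r - 1)) <= 1 / 8.
  apply: (@le_trans _ _ (a * (2 * geom r * 8 `^ (r - 1)))).
    apply: ler_wpM2r; first by rewrite mulr_ge0 ?(ltW E8)// mulr_ge0// ltW.
    by apply: ge1r_powR; rewrite ?a0 ?(ltW r1)//=; lra.
  rewrite /a /lower_width mulrC ler_pdivrMr//; lra.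
have sp : 0 < 1 / 8 / s1 `^ (- r) by rewrite !divr_gt0// powR_gt0.
have [M1 M1P] := powR_scale_vanish r1 (ltW (divr_gt0 a0 ka0)) sp.
exists (maxn M1 (Num.truncn (1 / 8 / (ka * s1))).+1) => m.
rewrite geq_max => /andP[/M1P[m0 mv] mB].
have m0R : 0 < m%:R :> R by rewrite ltr0n.
have km0 : 0 < ka * m%:R by rewrite mulr_gt0.
(* With this [b] the inner shell contributes [1/4] to the bound on [m ef], and the other two terms
   are at most [1/8] each. *)
pose b := 1 / 8 / (ka * m%:R); pose al := a / (ka * m%:R).
have b0 : 0 < b by rewrite !divr_gt0.
have al0 : 0 < al by rewrite divr_gt0.
have ab : al <= b by rewrite ler_pM2r ?invr_gt0.
have bs1 : b <= s1.
  have : 1 / 8 / (ka * s1) <= m%:R.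
    by apply: le_trans (ltW (truncnS_gt _)) _; rewrite ler_nat.
  by rewrite ![_ / (ka * _) <= _]ler_pdivrMr ?mulr_gt0// => h; rewrite (_ : s1 * (ka * m%:R) = m%:R * (ka * s1))//; ring.
have als1 := le_trans ab bs1.
have mflip := measurable_flipped msg.
have msh a' c := measurable_shell mw a' c.
have AT s : 0 < s -> s <= s1 -> (Q (setT `&` shell w 0 s) <= ((2 * ka) * s)%:E)%E.
  by move=> s0 ss; rewrite setTI Qub.
have A0 : 0 <= 2 * ka by rewrite mulr_ge0 ?ltW.
have [ef efE /andP[ef0 efle]] := integral_penal Q1 mw r1 al measurableT A0 b0 bs1 AT.
pose N := flipped sg `&` shell w 0 al.
have mN : measurable N by exact: measurableI.
have [q1 q1E] : exists q : R, Q (shell w 0 al) = q%:E.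
  exists (fine (Q (shell w 0 al))); rewrite fineK// ge0_fin_numE//.
  by rewrite (le_lt_trans (Qub al0 als1))// ltry.
have q1lb : ka * al / 2 <= q1 by rewrite -lee_fin -q1E Qlb.
pose e := p * q1.
have QN : Q N = e%:E by rewrite /N Qflip// q1E.
have q10 : 0 <= q1 by apply: le_trans q1lb; rewrite divr_ge0// mulr_ge0 ?ltW.
have e0 : 0 <= e by rewrite mulr_ge0 ?(ltW p0).
pose q z : R := \1_N z.
pose phi z := penal w r setT al b s1 z.
pose Er s : R := if score w sg r s < 0 then 1 else 0.
have q0 z : 0 <= q z by rewrite /q indicE.
have phi0 z : 0 <= phi z by exact: penal_ge0.
have qE : (\int[Q]_z (q z)%:E = e%:E)%E by exact: integral_indicE.
have mq : measurable_fun setT q by exact: measurable_indic.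
have mphi : measurable_fun setT phi by exact: measurable_penal.
(* The diagonal condition of [iexp_sum_mul]: points of [N] lie within [b], where the penalty is
   exactly 1. *)
have qphi z : q z * phi z = q z.
  rewrite /q indicE; have [|] := boolP (z \in N); last by rewrite mul0r.
  rewrite inE => -[_ /andP[z0 za]]; rewrite /phi penal_near ?mulr1//.
  by rewrite /shell/= z0 (le_trans za).
have mEr : seq_measurable (EFin \o Er).
  apply: (@seq_measurable_test _ _ _ (fun z => sg z * wpow w r z) (fun x => x < 0)) => //.
  by apply: measurable_fun_ltr => //; exact: measurable_cst.
have Er0 s : 0 <= Er s by rewrite /Er; case: ifP.
have S0 (g : Z -> R) s : (forall z, 0 <= g z) -> 0 <= \sum_(z <- s) g z.
  by move=> g0'; rewrite sumr_ge0.
have iq : iexp Q m (fun s => (\sum_(z <- s) q z)%:E) = (m%:R * e)%:E by exact: iexp_sum.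
have iqphi := iexp_sum_mul Q1 m mq mphi q0 phi0 qphi qE efE.
have key : ((2 * (m%:R * e))%:E <=
    iexp Q m (EFin \o Er) + (m%:R * e + m%:R * (m%:R - 1) * e * ef)%:E)%E.
  rewrite -iqphi -iexpD; last 4 first.
  - by move=> s; rewrite lee_fin.
  - by move=> s; rewrite lee_fin mulr_ge0 ?S0.
  - exact: mEr.
  - by apply: seq_measurable_mul; exact: seq_measurable_sum.
  rewrite EFinM -iq -iexpZ//; last 2 first.
  - by move=> s; rewrite lee_fin S0.
  - exact: seq_measurable_sum.
  apply: le_iexp => s; first by rewrite -EFinM lee_fin mulr_ge0// S0.
  by rewrite -EFinM -EFinD lee_fin; exact: penalties_le_error.
have far : m%:R * (al `^ r * s1 `^ (- r)) <= 1 / 8.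
  rewrite mulrA -ler_pdivlMr ?powR_gt0//; apply: le_trans mv.
  by rewrite (_ : a / ka / m%:R = al)// /al; field; rewrite !gt_eqF.
have near : m%:R * (2 * ka * b) = 1 / 4.
  by rewrite /b; field; rewrite !gt_eqF.
have mid : m%:R * (al `^ r * (2 * ka * geom r * b `^ (1 - r))) <= 1 / 8.
  apply: le_trans ag; rewrite le_eqVlt; apply/orP; left; apply/eqP.
  have ki0 : 0 < (ka * m%:R)^-1 by rewrite invr_gt0.
  have kE : m%:R * ka * (ka * m%:R)^-1 = 1 by rewrite [m%:R * ka]mulrC divff ?gt_eqF.
  have h18 : 0 < 1 / 8 :> R by lra.
  rewrite /b /al (powRM r (ltW a0) (ltW ki0)) (powRM (1 - r) (ltW h18) (ltW ki0)).
  have -> : (ka * m%:R)^-1 `^ (1 - r) = (ka * m%:R)^-1 * ((ka * m%:R)^-1) `^ (- r).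
    by rewrite powRD ?powRr1 ?(ltW ki0)// (gt_eqF ki0) implybT.
  have -> : (1 / 8) `^ (1 - r) = 8 `^ (r - 1) :> R.
    by rewrite div1r -powR_inv1// -powRrM mulN1r opprB.
  have hk := powR_mulN r ki0.
  move: hk kE; set k := (ka * m%:R)^-1; set x := k `^ r; set y := k `^ (- r).
  set u := a `^ r; set t := 8 `^ (r - 1) => hk kE.
  have -> : m%:R * (u * x * (2 * ka * geom r * (t * (k * y)))) =
    u * (2 * geom r * t) * (x * y) * (m%:R * ka * k) by ring.
  by rewrite hk kE !mulr1.
have mef : m%:R * ef <= 1 / 2.
  apply: le_trans (ler_wpM2l (ltW m0R) efle) _.
  rewrite !mulrDr; move: far near mid; lra.
have me : p * a / 2 <= m%:R * e.
  have -> : p * a / 2 = m%:R * (p * (ka * al / 2)) by rewrite /al; field; rewrite !gt_eqF.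
  by rewrite ler_pM2l// /e ler_pM2l.
(* Solving [key] for the error probability leaves [m e - m (m - 1) e ef >= m e / 2 >= p a / 4]. *)
move: key; rewrite -leeBlDr// => key; apply: le_trans key.
rewrite -EFinB lee_fin /lower_const -/a.
have h : m%:R * e * (m%:R * ef) <= m%:R * e * (1 / 2).
  by apply: ler_wpM2l => //; apply: mulr_ge0 => //; exact: ltW.
have h2 : 0 <= m%:R * e * ef by apply: mulr_ge0 => //; apply: mulr_ge0 => //; exact: ltW.
nra.
Qed.

End interpolation_bounds.

(** * Distances and Borel sets in R^n *)

Section borel_tuples.
Context (R : realType) (n : nat).
Implicit Types x y z : n.-tuple R.

(** An auxiliary metric: its triangle inequality and its approximation by rational points work
    coordinate by coordinate, and since it dominates [edist], Euclidean neighbourhoods contain l1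
    balls. *)
Definition l1dist x y : R := \sum_(i < n) `|tnth x i - tnth y i|.

Lemma l1dist_triangle x y z : l1dist x z <= l1dist x y + l1dist y z.
Proof.
rewrite /l1dist -big_split/=; apply: ler_sum => i _; exact: ler_distD.
Qed.

Lemma l1distC x y : l1dist x y = l1dist y x.
Proof. by apply: eq_bigr => i _; rewrite distrC. Qed.

Lemma l1dist_ge0 x y : 0 <= l1dist x y.
Proof. by apply: sumr_ge0. Qed.

Lemma l1dist_eq0 x y : l1dist x y <= 0 -> x = y.
Proof.
move=> h; apply: eq_from_tnth => i; apply/eqP; rewrite -subr_eq0 -normr_le0.
by apply: le_trans h; apply: (le_sum_mem (F := fun i => `|tnth x i - tnth y i|)) => //; rewrite mem_index_enum.
Qed.

Lemma edist_le_l1dist x y : Defs.edist x y <= l1dist x y.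
Proof.
rewrite /Defs.edist -(ger0_norm (l1dist_ge0 x y)) -sqrtr_sqr ler_wsqrtr//.
rewrite /l1dist; elim: (index_enum _) => [|i s IH]; first by rewrite !big_nil expr0n.
rewrite !big_cons [in leRHS]sqrrD real_normK ?num_real// -addrA lerD2l.
apply: le_trans IH _; rewrite lerDr mulrn_wge0// mulr_ge0//; exact: sumr_ge0.
Qed.

Lemma edist_eq0 x y : Defs.edist x y = 0 -> x = y.
Proof.
move=> /eqP; rewrite sqrtr_eq0 => h; apply: eq_from_tnth => i.
have : (tnth x i - tnth y i) ^+ 2 <= 0.
  apply: le_trans h; apply: (le_sum_mem (F := fun i => (tnth x i - tnth y i) ^+ 2)) => [|j _].
    by rewrite mem_index_enum.
  exact: sqr_ge0.
by rewrite le_eqVlt ltNge sqr_ge0 orbF sqrf_eq0 subr_eq0 => /eqP.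
Qed.

Lemma measurable_l1dist x : measurable_fun setT (l1dist x).
Proof.
apply: measurable_sum => i; apply: measurableT_comp; first exact: normr_measurable.
by apply: measurable_funB => //; exact: measurable_tnth.
Qed.

Lemma measurable_l1ball x e : measurable [set y | l1dist x y < e].
Proof.
rewrite (_ : [set y | _] = l1dist x @^-1` `]-oo, e[%classic); last first.
  by apply/seteqP; split=> y; rewrite /= in_itv.
rewrite -[X in measurable X]setTI.
exact: (measurable_l1dist x measurableT (measurable_itv _)).
Qed.

Lemma measurable_edist_pair : measurable_fun setT (fun q : n.-tuple R * n.-tuple R => Defs.edist q.1 q.2).
Proof.
apply: (measurableT_comp (f := @Num.sqrt R)).
  by apply: continuous_measurable_fun; exact: sqrt_continuous.
apply: measurable_sum => i; apply: measurable_funX; apply: measurable_funB.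
- exact: (measurableT_comp (@measurable_tnth _ _ _ i) measurable_fst).
- exact: (measurableT_comp (@measurable_tnth _ _ _ i) measurable_snd).
Qed.

Lemma measurable_edist x : measurable_fun setT (Defs.edist x).
Proof. exact: (measurableT_comp measurable_edist_pair (@measurable_pair1 _ _ _ _ x)). Qed.

Lemma measurable_set1_tuple x : measurable [set x].
Proof.
rewrite (_ : [set x] = l1dist x @^-1` `]-oo, 0]%classic); last first.
  apply/seteqP; split=> y /=; rewrite in_itv/=; last by move/l1dist_eq0.
  by move=> ->; rewrite /l1dist big1// => i _; rewrite subrr normr0.
rewrite -[X in measurable X]setTI.
exact: (measurable_l1dist x measurableT (measurable_itv _)).
Qed.

Lemma rat_l1dense x e : 0 < e ->
  exists q : n.-tuple rat, l1dist x [tuple ratr (tnth q i) | i < n] < e.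
Proof.
(* Dividing by [n + 1] keeps [n * eta < e] strict and covers [n = 0]. *)
move=> e0; pose eta := e / n.+1%:R.
have eta0 : 0 < eta by rewrite divr_gt0.
have hq i : exists q : rat, `|tnth x i - ratr q| < eta.
  have : tnth x i < tnth x i + eta by rewrite ltrDl.
  move=> /rat_in_itvoo[q]; rewrite in_itv/= => /andP[h1 h2]; exists q.
  by rewrite distrC ger0_norm ?subr_ge0 ?ltW// ltrBlDl.
have [q qP] := choice hq; exists [tuple q i | i < n].
apply: le_lt_trans (_ : n%:R * eta < e).
  rewrite /l1dist -[n in n%:R]card_ord -sum1_card natr_sum mulr_suml; apply: ler_sum => i _.
  by rewrite mul1r !tnth_mktuple ltW.
by rewrite /eta mulrA ltr_pdivrMr// mulrC ltr_pM2l// ltr_nat.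
Qed.

(* Borel because it is a union of l1 balls with rational centres and radii. *)
Lemma measurable_l1interior (P : set (n.-tuple R)) :
  measurable [set x | exists2 e, 0 < e & forall y, l1dist x y < e -> P y].
Proof.
pose c (q : n.-tuple rat) : n.-tuple R := [tuple ratr (tnth q i) | i < n].
pose F (qk : n.-tuple rat * nat) : set (n.-tuple R) :=
  if `[< [set y | l1dist (c qk.1) y < qk.2.+1%:R^-1] `<=` P >]
  then [set y | l1dist (c qk.1) y < qk.2.+1%:R^-1] else set0.
rewrite (_ : [set x | _] = \bigcup_qk F qk).
  apply: countable_bigcupT_measurable => [|qk]; [exact: countableP|rewrite /F].
  by case: ifP => _; [exact: measurable_l1ball|exact: measurable0].
apply/seteqP; split=> [x [e e0 xP]|x [qk _]].
  have e20 : 0 < e / 2 by rewrite divr_gt0.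
  pose k := Num.truncn (e / 2)^-1.
  have k0 : (0 : R) < k.+1%:R^-1 by rewrite invr_gt0.
  have ke : k.+1%:R^-1 <= e / 2.
    by rewrite -[leRHS]invrK lef_pV2 ?posrE ?invr_gt0// ltW// truncnS_gt.
  have [q qx] := rat_l1dense x k0.
  have qx' : l1dist (c q) x < k.+1%:R^-1 by rewrite l1distC.
  exists (q, k) => //; rewrite /F/=; case: asboolP => // h; exfalso; apply: h => y yq.
  apply: xP; apply: le_lt_trans (l1dist_triangle x (c q) y) _.
  have := ltrD qx yq; rewrite -/(c q) => /lt_le_trans; apply.
  by rewrite [leRHS]splitr lerD.
rewrite /F; case: asboolP => // PF xF.
exists (qk.2.+1%:R^-1 - l1dist (c qk.1) x); first by rewrite subr_gt0.
move=> y; rewrite ltrBrDr addrC => h; apply: PF => /=.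
by apply: le_lt_trans h; exact: l1dist_triangle.
Qed.

(** Off [A], continuity makes [a < g x] equivalent to [a < g] on a whole l1 ball around [x], which
    is a Borel condition on [x]. This yields Borel versions of [mu] and [f]. *)
Lemma measurable_cont_off (A : set (n.-tuple R)) (g : n.-tuple R -> R) (c : R) :
  measurable A -> (forall x, ~ A x -> cont_at g x) ->
  measurable_fun setT (fun x => if `[< A x >] then c else g x).
Proof.
move=> mA cg; apply: (measurability _ (RGenOInfty.measurableE R)) => //.
move=> _ [_ [a ->] <-]; rewrite setTI.
pose I := [set x | exists2 e, 0 < e & forall y, l1dist x y < e -> a < g y].
rewrite (_ : _ @^-1` _ = (if a < c then A else set0) `|` (~` A `&` I)).
  apply: measurableU; first by case: ifP => _ //; exact: measurable0.
  by apply: measurableI; [exact: measurableC|exact: measurable_l1interior].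
apply/seteqP; split=> x /=; rewrite in_itv/= andbT.
  case: asboolP => Ax; first by move=> ac; left; rewrite ac.
  move=> ag; right; split => //.
  have [del del0 h] := cg x Ax (g x - a) ltac:(by rewrite subr_gt0).
  exists del => // y xy; have := h y (le_lt_trans (edist_le_l1dist x y) xy).
  by rewrite ltr_norml => /andP[+ _]; rewrite opprB ltrBrDr subrK.
case=> [|[Ax [e e0 h]]].
  by case: ifP => // ac Ax; case: asboolP.
case: asboolP => // _; apply: h.
by rewrite /l1dist big1// => i _; rewrite subrr normr0.
Qed.

Lemma loc_const_cont (f : n.-tuple R -> R) x : loc_const_at f x -> cont_at f x.
Proof. by move=> [e e0 h] eps eps0; exists e => // y /h ->; rewrite subrr normr0. Qed.

End borel_tuples.

(** * Change of variables by translation and scaling *)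

Section affine_maps.
Context (R : realType).

Definition affine_tuple n (a : n.-tuple R) (t : R) (y : n.-tuple R) : n.-tuple R :=
  [tuple tnth a i + t * tnth y i | i < n].

Lemma affine_tuple_cons n (a0 : R) (a : n.-tuple R) t y0 (y : n.-tuple R) :
  affine_tuple (cons_tuple a0 a) t (cons_tuple y0 y) =
  cons_tuple (a0 + t * y0) (affine_tuple a t y).
Proof.
apply: eq_from_tnth => i; rewrite tnth_mktuple.
have [->|[j ->]] : i = ord0 \/ exists j, i = lift ord0 j.
  by case: (unliftP ord0 i) => [j|] ->; [right; exists j|left].
- by rewrite !tnth0.
- by rewrite !tnthS tnth_mktuple.
Qed.

Lemma measurable_affine_tuple n (a : n.-tuple R) t : measurable_fun setT (affine_tuple a t).
Proof.
apply/measurable_fun_tnthP => i.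
rewrite (_ : _ \o _ = (fun y => tnth a i + t * tnth y i)); last first.
  by apply/funext => y /=; rewrite tnth_mktuple.
apply: measurable_funD => //; apply: measurable_funM => //; exact: measurable_tnth.
Qed.

(** The pushforward of Lebesgue measure by [x |-> a + t x], multiplied by [t], agrees with Lebesgue
    measure on half-open intervals, hence everywhere. *)
Lemma lebesgue_affine (a t : R) (g : R -> \bar R) : 0 < t ->
  measurable_fun setT g -> (forall x, (0 <= g x)%E) ->
  (\int[@lebesgue_measure R]_x g x =
   t%:E * \int[@lebesgue_measure R]_x g (a + t * x)%R)%E.
Proof.
move=> t0 mg g0; pose psi (x : R) : R := a + t * x.
have mpsi : measurable_fun setT psi.
  by apply: measurable_funD => //; exact: measurable_funM.
pose pf : {measure set (measurableTypeR R) -> \bar R} :=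
  pushforward (@lebesgue_measure R) (psi : measurableTypeR R -> measurableTypeR R).
pose m := mscale (NngNum (ltW t0)) (pf mpsi).
transitivity (\int[m]_x g x)%E.
  apply: eq_measure_integral => /= A mA _.
  apply: lebesgue_measure_unique => // _ [[u v] _ <-] /=.
  rewrite /m /mscale/= /pushforward.
  rewrite (_ : psi @^-1` _ = `](u - a) / t, (v - a) / t]%classic); last first.
    apply/seteqP; split=> x; rewrite /psi/= !in_itv/=.
      by rewrite ltr_pdivrMr// ler_pdivlMr// ltrBlDl lerBrDl (mulrC x).
    by rewrite ltr_pdivrMr// ler_pdivlMr// ltrBlDl lerBrDl (mulrC x).
  rewrite !lebesgue_measure_itv/= !lte_fin ltr_pM2r ?invr_gt0// ltrD2r.
  case: ifP => _; last by rewrite mule0.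
  by rewrite -!EFinB -EFinM; congr _%:E; field; rewrite gt_eqF.
rewrite ge0_integral_mscale//=; congr (_ * _)%E.
have h := @ge0_integral_pushforward _ _ (measurableTypeR R) (measurableTypeR R) R psi mpsi (@lebesgue_measure R) setT g measurableT mg.
by rewrite preimage_setT in h; apply: h => y _; exact: g0.
Qed.

(** By induction on the dimension: the tail coordinates give [t^n], the first coordinate one more
    factor [t]. *)
Lemma lint_affine n (a : n.-tuple R) t (g : n.-tuple R -> \bar R) : 0 < t ->
  measurable_fun setT g -> (forall x, (0 <= g x)%E) ->
  (lint g = (t ^+ n)%:E * lint (fun y => g (affine_tuple a t y)))%E.
Proof.
move=> t0; elim: n a g => [|n IH] a g mg g0.
  by rewrite expr0 mul1e/=; congr g; apply: eq_from_tnth => -[].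
case/tupleP: a => a0 a; have [m mE] := lint_measure R n.
have mfib h : measurable_fun setT h -> forall x : R,
    measurable_fun setT (fun y => h (cons_tuple x y) : \bar R).
  by move=> mh x; exact: (measurableT_comp mh (measurable_cons_at x)).
have mint (h : n.+1.-tuple R -> \bar R) : measurable_fun setT h ->
    (forall x, (0 <= h x)%E) -> measurable_fun setT (fun x => lint (fun y => h (cons_tuple x y))).
  move=> mh h0; have -> : (fun x => lint (fun y => h (cons_tuple x y))) =
      fubini_F m (fun p : R * n.-tuple R => h (cons_tuple p.1 p.2)).
    by apply/funext => x; rewrite mE//; exact: mfib.
  apply: measurable_fun_fubini_tonelli_F => //.
  exact: (measurableT_comp mh (@measurable_cons_pair R n)).
rewrite /=.
transitivity (\int[@lebesgue_measure R]_x
   ((t ^+ n)%:E * lint (fun y => g (cons_tuple x (affine_tuple a t y)))))%E.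
  by apply: eq_integral => x _; rewrite (IH a)//; exact: mfib.
pose G := fun x : R => lint (fun y => g (cons_tuple x (affine_tuple a t y))).
have mG : measurable_fun setT G.
  have -> : G = fubini_F m (fun p : R * n.-tuple R => g (cons_tuple p.1 (affine_tuple a t p.2))).
    apply/funext => x; rewrite /G mE//.
    apply: (measurableT_comp (f := fun y => g (cons_tuple x y)) _ (measurable_affine_tuple a t)); exact: mfib.
  apply: measurable_fun_fubini_tonelli_F => //.
  apply: (measurableT_comp mg).
  apply: (@measurable_cons _ _ _ _ (fst : R * n.-tuple R -> R) n (fun p => affine_tuple a t p.2)).
    exact: measurable_fst.
  exact: (measurableT_comp (measurable_affine_tuple a t) measurable_snd).
have G0 x : (0 <= G x)%E by apply: lint_ge0.
have tn0 : (0 <= (t ^+ n)%:E)%E by rewrite lee_fin exprn_ge0 ?ltW.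
have -> : (\int[@lebesgue_measure R]_x ((t ^+ n)%:E * G x) =
    (t ^+ n)%:E * \int[@lebesgue_measure R]_x G x)%E.
  by apply: ge0_integralZl_EFin => //; exact: exprn_ge0 (ltW t0).
rewrite (lebesgue_affine a0 t0 mG G0) muleA -EFinM -exprSr; congr (_ * _)%E.
apply: eq_integral => x _; apply: eq_lint => y.
by rewrite affine_tuple_cons.
Qed.

Lemma edist_affine n (a : n.-tuple R) t y : 0 < t ->
  Defs.edist a (affine_tuple a t y) = t * Defs.edist [tuple 0 | i < n] y.
Proof.
move=> t0; rewrite /Defs.edist -[t in RHS](ger0_norm (ltW t0)) -sqrtr_sqr -sqrtrM ?sqr_ge0//.
congr Num.sqrt; rewrite mulr_sumr; apply: eq_bigr => i _.
by rewrite !tnth_mktuple; ring.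
Qed.

End affine_maps.

(** * Monotonicity of lower and upper limits *)

Section limits.
Context (R : realType).
Local Open Scope ereal_scope.

Lemma le_limn_esup (u v : (\bar R)^nat) : (forall n, u n <= v n) ->
  limn_esup u <= limn_esup v.
Proof.
move=> uv; rewrite !limn_esup_lim; apply: lee_lim; [exact: is_cvg_esups..|].
apply: nearW => n; apply: ge_ereal_sup => _ [k /= nk <-].
by apply: le_trans (uv k) _; apply: ereal_sup_ubound; exists k.
Qed.

Lemma le_limn_einf (u v : (\bar R)^nat) : (forall n, u n <= v n) ->
  limn_einf u <= limn_einf v.
Proof.
by move=> uv; rewrite /limn_einf leeN2; apply: le_limn_esup => n; rewrite leeN2.
Qed.

End limits.

(** * Null sets, volumes of balls and the law of a labelled point *)

Lemma lint0 (R : realType) n : lint (fun _ : n.-tuple R => 0%E : \bar R) = 0%E.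
Proof.
by elim: n => [//|n IH] /=; apply: integral0_eq => x _; exact: IH.
Qed.

(** The slice is empty unless the first coordinate is that of [a], and a single real is
    Lebesgue-null. In dimension 0 the only point has volume 1. *)
Lemma leb_vol_set1 (R : realType) d (a : d.-tuple R) : (0 < d)%N ->
  leb_vol [set a] = 0%E.
Proof.
case: d a => // n a _; rewrite /leb_vol/=.
rewrite -[RHS](integral0 (@lebesgue_measure R) setT).
apply: (@ge0_null_eq_integral_any _ (measurableTypeR R) R (@lebesgue_measure R)
  [set thead a] _ (fun=> 0%E)) => [||x|//|x xa].
- exact: measurable_set1.
- exact: lebesgue_measure_set1.
- by apply: lint_ge0 => t; rewrite lee_fin indicE.
- rewrite -[RHS](lint0 R n); apply: eq_lint => t; rewrite indicE memNset// => xt.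
  by apply: xa; rewrite -xt /= theadE.
Qed.

Section lebesgue_tuples.
Context (R : realType) (d : nat).
Variable lam : {sigma_finite_measure set (d.-tuple R) -> \bar R}.
Hypothesis lamE : forall g, measurable_fun setT g -> (forall x, (0 <= g x)%E) ->
  lint g = (\int[lam]_x g x)%E.

Lemma leb_volE A : measurable A -> leb_vol A = lam A.
Proof.
move=> mA; rewrite /leb_vol lamE; last 2 first.
- by apply/measurable_EFinP; exact: measurable_indic.
- by move=> x; rewrite lee_fin indicE.
by rewrite integral_indic// setIT.
Qed.

Lemma singleton_null a : (0 < d)%N -> lam [set a] = 0%E.
Proof.
by move=> d0; rewrite -leb_volE ?leb_vol_set1//; exact: measurable_set1_tuple.
Qed.

(** Used to discard the training points, where the interpolator returns a stored label. *)
Lemma seq_null (A : set (d.-tuple R)) (l : seq (d.-tuple R)) : (0 < d)%N ->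
  measurable A -> lam A = 0%E ->
  exists B, [/\ measurable B, lam B = 0%E, A `<=` B & forall x, x \in l -> B x].
Proof.
move=> d0 mA A0; elim: l => [|a l [B [mB B0 AB lB]]]; first by exists A; split => // x; rewrite in_nil.
have m1 := measurable_set1_tuple a.
exists (B `|` [set a]); split.
- exact: measurableU.
- by rewrite measureU0//; exact: singleton_null.
- by move=> x /AB; left.
- by move=> x; rewrite inE => /orP[/eqP ->|/lB]; [right|left].
Qed.

(** A punctured ball of radius [s^(1/d)], so that its volume is linear in [s]. The centre is left
    out to match [shell], whose lower bound is strict. *)
Definition pball (x : d.-tuple R) (s : R) : set (d.-tuple R) :=
  [set y | 0 < Defs.edist x y ^+ d <= s].

Lemma measurable_pball x s : measurable (pball x s).
Proof.
rewrite (_ : pball x s = (fun y => Defs.edist x y ^+ d) @^-1` `]0, s]%classic); last first.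
  by apply/seteqP; split=> y; rewrite /pball/= in_itv.
rewrite -[X in measurable X]setTI.
exact: (measurable_funX d (@measurable_edist R d x) measurableT (measurable_itv _)).
Qed.

Definition pball_vol : \bar R := lam (pball [tuple 0 | i < d] 1).

(** Scaling by [rho = s^(1/d)] and translating by [x] carries the unit ball to this one, with volume
    factor [rho^d = s]. *)
Lemma lam_pball x s : (0 < d)%N -> 0 < s -> (lam (pball x s) = s%:E * pball_vol)%E.
Proof.
move=> d0 s0; pose rho := s `^ (d%:R^-1).
have rho0 : 0 < rho by rewrite powR_gt0.
have rhoE : rho ^+ d = s.
  by rewrite -powR_mulrn ?powR_ge0// -powRrM mulVf ?powRr1 ?(ltW s0)// pnatr_eq0 -lt0n.
have i0 (A : set (d.-tuple R)) y : (0 <= (\1_A y : R)%:E)%E by rewrite lee_fin indicE.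
rewrite /pball_vol -!leb_volE; try exact: measurable_pball.
rewrite /leb_vol (lint_affine x rho0)//; last first.
  by apply/measurable_EFinP; apply: measurable_indic; exact: measurable_pball.
rewrite rhoE; congr (_ * _)%E; apply: eq_lint => y; congr (_%:E).
rewrite !indicE; congr ((nat_of_bool _)%:R); apply/idP/idP; rewrite !inE /pball/= edist_affine// exprMn rhoE.
  by rewrite pmulr_rgt0// -[X in _ <= X]mulr1 ler_pM2l.
by rewrite pmulr_rgt0// -[X in _ -> _ && (_ <= X)]mulr1 ler_pM2l.
Qed.

(** If the unit ball were null, so would be all balls around the origin by scaling, and countably
    many of them together with the origin cover the space. *)
Lemma pball_vol_gt0 : (0 < d)%N -> lam setT != 0%E -> (0 < pball_vol)%E.
Proof.
move=> d0; apply: contra_neqT; rewrite -leNgt => v0.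
have {}v0 : pball_vol = 0%E by apply/le_anti; rewrite v0 measure_ge0.
pose o : d.-tuple R := [tuple 0 | i < d].
have : lam.-negligible (\bigcup_k ([set o] `|` pball o k.+1%:R)).
  apply: negligible_bigcup => k; apply/negligibleP.
    by apply: measurableU; [exact: measurable_set1_tuple|exact: measurable_pball].
  apply: null_set_setU.
  - exact: measurable_set1_tuple.
  - exact: measurable_pball.
  - exact: singleton_null.
  - by rewrite [LHS]lam_pball// v0 mule0.
move=> [B [mB B0 sB]]; apply/le_anti; rewrite measure_ge0 andbT -B0.
apply: le_measure; rewrite ?inE// => y _; apply: sB.
have [->|yo] := pselect (y = o); first by exists 0%N => //; left.
exists (Num.truncn (Defs.edist o y ^+ d)) => //; right; rewrite /pball/=.
rewrite (ltW (truncnS_gt _)) andbT exprn_gt0// lt_neqAle sqrtr_ge0 andbT eq_sym.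
by apply/eqP => /edist_eq0 /esym.
Qed.

(** The law is the measure with density [h] times a Bernoulli coin; the value [true] stands for a
    flipped label. *)
Lemma law_exists (h : d.-tuple R -> R) (p : R) : measurable_fun setT h ->
  (forall x, 0 <= h x) -> lint (fun x => (h x)%:E) = 1%E -> 0 <= p <= 1 ->
  exists Q : {sigma_finite_measure set (d.-tuple R * bool)%type -> \bar R},
    forall g, measurable_fun setT g -> (forall z, (0 <= g z)%E) ->
    (\int[Q]_z g z = lint (fun x => (h x)%:E *
       ((1 - p)%:E * g (x, false) + p%:E * g (x, true))))%E.
Proof.
move=> mh h0 h1 p01; have /andP[p0 p1] := p01.
pose pf : {measure set (d.-tuple R) -> \bar R} := mdensity lam h.
pose P0 := pf mh h0.
have P0f : sigma_finite setT P0.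
  exists (fun=> setT); first by rewrite bigcup_const.
  move=> _; split => //; rewrite /P0/pf/= /mdensity -lamE; last 2 first.
  - exact/measurable_EFinP.
  - by move=> x; rewrite lee_fin.
  by rewrite h1 ltry.
pose P : {sigma_finite_measure set (d.-tuple R) -> \bar R} :=
  HB.pack (Measure.sort P0) (Measure_isSigmaFinite.Build _ _ _ _ P0f).
have [Q QE] := sigma_finite_product_transport P (bernoulli_prob p)
  (phi := id) (psi := id) (@measurable_id _ _ _) (@measurable_id _ _ _) (fun x => erefl).
exists Q => g mg g0; rewrite QE//.
have mgb b : measurable_fun setT (fun x => g (x, b)).
  exact: (measurableT_comp mg (@measurable_pair2 _ _ _ _ b)).
have mG : measurable_fun setT
    (fun x => ((1 - p)%:E * g (x, false) + p%:E * g (x, true))%E).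
  by apply: emeasurable_funD; apply: emeasurable_funM.
have G0 x : (0 <= (1 - p)%:E * g (x, false) + p%:E * g (x, true))%E.
  by rewrite adde_ge0 ?mule_ge0 ?lee_fin ?subr_ge0.
rewrite lamE; last 2 first.
- by apply: emeasurable_funM => //; exact/measurable_EFinP.
- by move=> x; rewrite mule_ge0 ?lee_fin.
apply: etrans (integral_mdensity lam mh h0 mG G0).
apply: eq_integral => x _.
by rewrite (integral_bernoulli_prob p01)// addeC.
Qed.

End lebesgue_tuples.

(** * From a fixed query point to the expected clean error *)

Section nadaraya_watson.
Context (R : realType) (d : nat) (beta p : R) (mu f : d.-tuple R -> R).
Variable lam : {sigma_finite_measure set (d.-tuple R) -> \bar R}.
Hypothesis lamE : forall g, measurable_fun setT g -> (forall x, (0 <= g x)%E) ->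
  lint g = (\int[lam]_x g x)%E.
Hypotheses (d0 : (0 < d)%N) (dbeta : d%:R < beta).
Hypotheses (mu0 : forall x, 0 <= mu x) (mu1 : lint (fun x => (mu x)%:E) = 1%E).
Hypothesis fE : forall x, f x = 1 \/ f x = -1.
Variable A : set (d.-tuple R).
Hypotheses (mA : measurable A) (A0 : lam A = 0%E).
Hypotheses (cmu : forall x, ~ A x -> cont_at mu x)
  (cf : forall x, ~ A x -> loc_const_at f x).
Hypotheses (p0 : 0 < p) (p49 : p < 49 / 100).

Let T := (d.-tuple R * bool)%type.
Let r := beta / d%:R.

(* [mu] and [f] are not assumed measurable; off the null set [A] they agree with
   these Borel functions. *)
Let bmu x := if `[< A x >] then 0 else mu x.
Let bf x := if `[< A x >] then 1 else f x.

Let r1 : 1 < r.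
Proof. by rewrite /r ltr_pdivlMr ?mul1r// ltr0n. Qed.

Let mbmu : measurable_fun setT bmu.
Proof. exact: measurable_cont_off. Qed.

Let mbf : measurable_fun setT bf.
Proof. by apply: measurable_cont_off => // x /cf; exact: loc_const_cont. Qed.

Let bmu0 x : 0 <= bmu x.
Proof. by rewrite /bmu; case: ifP. Qed.

Let bfE x : bf x = 1 \/ bf x = -1.
Proof. by rewrite /bf; case: ifP => _; [left|exact: fE]. Qed.

Let bmuE x : ~ A x -> bmu x = mu x.
Proof. by move=> Ax; rewrite /bmu; case: asboolP. Qed.

Let bfA x : ~ A x -> bf x = f x.
Proof. by move=> Ax; rewrite /bf; case: asboolP. Qed.

Let lintA (g h : d.-tuple R -> \bar R) : (forall x, (0 <= g x)%E) ->
  (forall x, (0 <= h x)%E) -> (forall x, ~ A x -> g x = h x) -> lint g = lint h.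
Proof. by apply: lint_null_eq => //; rewrite (leb_volE lamE). Qed.

Let bmu1 : lint (fun x => (bmu x)%:E) = 1%E.
Proof.
rewrite -mu1; apply: lintA => x; rewrite ?lee_fin//.
by move=> /bmuE ->.
Qed.

Let p1 : 0 <= 1 - p. Proof. by move: p49; lra. Qed.
Let p01 : 0 <= p <= 1. Proof. by rewrite ltW//=; move: p49; lra. Qed.

Variable Q : {sigma_finite_measure set T -> \bar R}.
Hypothesis QE : forall g, measurable_fun setT g -> (forall z, (0 <= g z)%E) ->
  (\int[Q]_z g z = lint (fun x => (bmu x)%:E *
    ((1 - p)%:E * g (x, false) + p%:E * g (x, true))))%E.

Let Q1 : Q setT = 1%E.
Proof.
rewrite -bmu1 -[LHS]mul1e -integral_cst// QE//.
by apply: eq_lint => x; rewrite /= !mule1 -EFinD subrK mule1.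
Qed.

(** Turns a point with a coin into a labelled example, using the Borel version [bf] of the target so
    that labels are measurable. *)
Let emb (z : T) : d.-tuple R * R := (z.1, if z.2 then - bf z.1 else bf z.1).
Let wx (x : d.-tuple R) (z : T) : R := Defs.edist x z.1 ^+ d.
Let sx (x : d.-tuple R) (z : T) : R := bf x * (emb z).2.

Let mwx2 : measurable_fun setT (fun q : d.-tuple R * T => wx q.1 q.2).
Proof.
apply: measurable_funX.
apply: (measurableT_comp (@measurable_edist_pair R d)
  (g := fun q : d.-tuple R * T => (q.1, q.2.1))).
apply: measurable_fun_pair; first exact: measurable_fst.
exact: (measurableT_comp measurable_fst measurable_snd).
Qed.

Let msx2 : measurable_fun setT (fun q : d.-tuple R * T => sx q.1 q.2).
Proof.
have m21 : measurable_fun setT (fun q : d.-tuple R * T => bf q.2.1).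
  exact: (measurableT_comp mbf (measurableT_comp measurable_fst measurable_snd)).
apply: measurable_funM; first exact: (measurableT_comp mbf measurable_fst).
apply: measurable_fun_ifT => //; last exact: measurableT_comp.
exact: (measurableT_comp measurable_snd measurable_snd).
Qed.

Let mwx x : measurable_fun setT (wx x).
Proof. exact: (measurableT_comp mwx2 (@measurable_pair1 _ _ _ T x)). Qed.

Let msx x : measurable_fun setT (sx x).
Proof. exact: (measurableT_comp msx2 (@measurable_pair1 _ _ _ T x)). Qed.

Let wx0 x z : 0 <= wx x z. Proof. by rewrite exprn_ge0// sqrtr_ge0. Qed.

Let sxE x z : sx x z = 1 \/ sx x z = -1.
Proof.
rewrite /sx /emb/=; case: (bfE x) => ->; case: (bfE z.1) => ->; case: z.2;
  rewrite ?mulN1r ?mul1r ?opprK; by [left|right].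
Qed.

Let sc x s := score (wx x) (sx x) r s.
(** A tie counts as an error, because [Num.sg 0 = 0] differs from both labels. *)
Let er x s : R := if sc x s <= 0 then 1 else 0.

Let er0 x s : 0 <= er x s. Proof. by rewrite /er; case: ifP. Qed.

Let mer m : measurable_fun setT (fun q : d.-tuple R * m.-tuple T => (er q.1 q.2)%:E).
Proof.
apply/measurable_EFinP; apply: measurable_fun_ifT => //.
apply: measurable_fun_ler => //.
rewrite (_ : (fun q : d.-tuple R * m.-tuple T => sc q.1 q.2) =
   (fun q => \sum_(i < m) sx q.1 (tnth q.2 i) * wx q.1 (tnth q.2 i) `^ (- r))); last first.
  by apply/funext => q; rewrite /sc /score big_tuple.
apply: measurable_sum => i.
have mt : measurable_fun setT (fun q : d.-tuple R * m.-tuple T => (q.1, tnth q.2 i)).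
  apply: measurable_fun_pair; first exact: measurable_fst.
  exact: (measurableT_comp (@measurable_tnth _ _ _ i) measurable_snd).
apply: measurable_funM; first exact: (measurableT_comp msx2 mt).
exact: (measurableT_comp (@measurable_powR R (- r)) (measurableT_comp mwx2 mt)).
Qed.

Let mer1 x : seq_measurable (fun s => (er x s)%:E).
Proof. by move=> m; exact: (measurableT_comp (@mer m) (@measurable_pair1 _ _ _ _ x)). Qed.

Let merx (s : seq T) : measurable_fun setT (fun x => (er x s)%:E).
Proof. exact: (measurableT_comp (@mer (size s)) (@measurable_pair2 _ _ _ _ (in_tuple s))). Qed.

Let sgn_err (u v : R) : v = 1 \/ v = -1 -> (Num.sg u != v) = (v * u <= 0).
Proof.
have n1 : (-1 == 1 :> R) = false by apply/eqP; lra.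
have n2 : (1 == -1 :> R) = false by apply/eqP; lra.
have n3 : (0 == 1 :> R) = false by apply/eqP; lra.
have n4 : (0 == -1 :> R) = false by apply/eqP; lra.
by case=> ->; case: sgrP => [->|u0|u0]; rewrite ?n1 ?n2 ?n3 ?n4 ?eqxx/=;
  apply/esym; [apply/idP|apply/negbTE|apply/idP|apply/idP|apply/idP|apply/negbTE];
  rewrite -?ltNge; lra.
Qed.

(** As [beta = d r], raising the d-th power of the distance to [-r] gives the distance to the power
    [-beta]. *)
Let scE x s :
  bf x * (\sum_(z <- map emb s) z.2 * Defs.edist x z.1 `^ (- beta)) = sc x s.
Proof.
rewrite /sc /score big_map mulr_sumr; apply: eq_bigr => z _.
rewrite mulrA; congr (_ * _); rewrite /wpow /wx -powR_mulrn ?sqrtr_ge0// -powRrM.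
by rewrite mulrN mulrC /r divfK// pnatr_eq0 -lt0n.
Qed.

(** Away from [A] and the finitely many training points, which together form a null set, the
    prediction is the sign of the weighted vote. *)
Let clean_errE s :
  clean_err mu f beta (map emb s) = (\int[lam]_x ((bmu x)%:E * (er x s)%:E))%E.
Proof.
have mbe : measurable_fun setT (fun x => ((bmu x)%:E * (er x s)%:E)%E).
  by apply: emeasurable_funM => //; exact/measurable_EFinP.
have be0 x : (0 <= (bmu x)%:E * (er x s)%:E)%E by rewrite mule_ge0 ?lee_fin.
have [B [mB B0 AB lB]] := seq_null lamE (map (fun z => (emb z).1) s) d0 mA A0.
rewrite -lamE// /clean_err; apply: (lint_null_eq mB); rewrite ?(leb_volE lamE)//.
  by move=> x; rewrite lee_fin mulr_ge0//; case: ifP.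
move=> x Bx; have Ax : ~ A x by move=> /AB.
rewrite -EFinM bmuE//; congr (_%:E); congr (_ * _).
have -> : nw_interp beta (map emb s) x =
    Num.sg (\sum_(z <- map emb s) z.2 * Defs.edist x z.1 `^ (- beta)).
  rewrite /nw_interp/= ifF//; apply/negbTE/hasPn => z /mapP[t ts ->].
  by apply/eqP => tx; apply: Bx; apply: lB; apply/mapP; exists t.
by rewrite sgn_err// -(bfA Ax) scE.
Qed.

Let clean_err0 s : (0 <= clean_err mu f beta s)%E.
Proof. by apply: lint_ge0 => x; rewrite lee_fin mulr_ge0//; case: ifP. Qed.

Let sample_exp_ge0 k F : (forall s, (0 <= F s)%E) -> (0 <= sample_exp mu f p k F)%E.
Proof.
elim: k F => [|k IH] F F0 /=; first exact: F0.
apply: lint_ge0 => x; apply: mule_ge0; first by rewrite lee_fin.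
by apply: adde_ge0; apply: mule_ge0; rewrite ?lee_fin ?(ltW p0)//; apply: IH.
Qed.

(** Each draw is an integral over [x], unchanged when [mu] and [f] are replaced by their Borel
    versions off [A]; the formula for [Q] then matches the recursion of [sample_exp]. *)
Let sample_exp_iexp m F : (forall s, (0 <= F s)%E) -> seq_measurable (F \o map emb) ->
  sample_exp mu f p m F = iexp Q m (F \o map emb).
Proof.
elim: m F => [//|m IH] F F0 mF /=.
rewrite QE; last 2 first.
- by apply: (@measurable_iexp_cons _ _ _ Q m (F \o map emb)) => // s; exact: F0.
- by move=> z; apply: iexp_ge0 => s; exact: F0.
apply: lintA => [x|x|x Ax].
- by rewrite mule_ge0 ?lee_fin// adde_ge0// mule_ge0 ?lee_fin ?sample_exp_ge0// ltW.
- by rewrite mule_ge0 ?lee_fin// adde_ge0// mule_ge0 ?lee_fin ?(ltW p0)//; apply: iexp_ge0 => s; exact: F0.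
rewrite bmuE// -(bfA Ax) !IH//.
- exact: (seq_measurable_cons (F := F \o map emb) (x, true)).
- exact: (seq_measurable_cons (F := F \o map emb) (x, false)).
Qed.

Let pi m x : \bar R := iexp Q m (fun s => (er x s)%:E).

(** Tonelli's theorem moves the sample expectation inside the integral over the query point. *)
Let exp_errE m : exp_err mu f p beta m = (\int[lam]_x ((bmu x)%:E * pi m x))%E.
Proof.
have mbe k : measurable_fun setT (fun q : d.-tuple R * k.-tuple T => ((bmu q.1)%:E * (er q.1 q.2)%:E)%E).
  apply: emeasurable_funM; last exact: mer.
  apply/measurable_EFinP; apply: (measurableT_comp (f := bmu)); first exact: mbmu.
  exact: measurable_fst.
have be0 x s : (0 <= (bmu x)%:E * (er x s)%:E)%E by rewrite mule_ge0 ?lee_fin.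
rewrite /exp_err sample_exp_iexp//; last first.
  move=> k; have -> : (fun t : k.-tuple T => (clean_err mu f beta \o map emb) t) =
      fubini_G lam (fun q : d.-tuple R * k.-tuple T => ((bmu q.1)%:E * (er q.1 q.2)%:E)%E).
    by apply/funext => t /=; rewrite clean_errE.
  by apply: measurable_fun_fubini_tonelli_G => [|q]; [exact: mbe|exact: be0].
transitivity (iexp Q m (fun s => \int[lam]_x ((bmu x)%:E * (er x s)%:E))%E).
  by congr iexp; apply/funext => s /=; rewrite clean_errE.
rewrite -(@integral_iexp _ _ _ Q m _ _ lam (fun x s => ((bmu x)%:E * (er x s)%:E)%E))//.
by apply: eq_integral => x _; rewrite iexpZ// => s; rewrite lee_fin.
Qed.

Let mpi m : measurable_fun setT (pi m).
Proof.
by apply: (@measurable_iexp _ _ _ Q m _ _ (fun x s => (er x s)%:E)) => // x s; rewrite lee_fin.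
Qed.

Let pi0 m x : (0 <= pi m x)%E.
Proof. by apply: iexp_ge0 => s; rewrite lee_fin. Qed.

Let pi1 m x : (pi m x <= 1)%E.
Proof.
rewrite -(iexp_cst Q1 m 1); apply: le_iexp => s; first by rewrite lee_fin.
by rewrite lee_fin /er; case: ifP.
Qed.

Let hb : (\int[lam]_x (bmu x)%:E = 1)%E.
Proof.
by rewrite -bmu1 lamE//; exact/measurable_EFinP.
Qed.

Let lamT : lam setT != 0%E.
Proof.
apply/eqP => lT; have : (1 = 0 :> \bar R)%E.
  rewrite -hb -(integral0 lam setT).
  by apply: (ge0_null_eq_integral_any measurableT lT) => // x; first [by rewrite lee_fin | by case].
by move=> /eqP; rewrite eqe oner_eq0.
Qed.

Let V := pball_vol lam.

Let lintc (c : R) (E : set (d.-tuple R)) : 0 <= c -> measurable E ->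
  lint (fun y => (c * \1_E y)%:E) = (c%:E * lam E)%E.
Proof.
move=> c0 mE; have mI : measurable_fun setT (fun y => (\1_E y : R)%:E).
  by apply/measurable_EFinP; exact: measurable_indic.
have i0 y : (0 <= (\1_E y : R)%:E)%E by rewrite lee_fin indicE.
rewrite lamE; last 2 first.
- by apply/measurable_EFinP; apply: measurable_funM => //; exact: measurable_indic.
- by move=> y; rewrite lee_fin mulr_ge0// indicE.
under eq_integral do rewrite EFinM.
by rewrite ge0_integralZl_EFin// integral_indic// setIT.
Qed.

Let QsetE (C : set T) : measurable C -> Q C = lint (fun y =>
  (bmu y * ((1 - p) * \1_C (y, false) + p * \1_C (y, true)))%:E).
Proof.
move=> mC; rewrite -[C in LHS]setIT -integral_indic// QE//.
by apply/measurable_EFinP; exact: measurable_indic.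
Qed.

(** Checks the hypotheses of the abstract bounds with [ka = v * mu x], where [v] is the volume of
    the unit ball: near [x] the density stays within a factor 2 of [mu x] and the target is
    constant. The threshold [M] depends on [x]. *)
Let pi_eventually x : ~ A x -> 0 < mu x -> exists M : nat, forall m, (M <= m)%N ->
  ((lower_const r * p)%:E <= pi m x)%E /\
  (pi m x <= (upper_const r * (ln (1 / p)) `^ (1 / (1 - r^-1)) * p)%:E)%E.
Proof.
move=> Ax mux; have mux2 : 0 < mu x / 2 by rewrite divr_gt0.
have [d1 d10 h1] := cmu Ax mux2; have [d2 d20 h2] := cf Ax.
(* Halving turns the closed condition [edist x y <= dl] into the strict ones required by [h1] and
   [h2]. *)
pose dl := Order.min d1 d2 / 2; pose s1 := dl ^+ d.
have m0 : 0 < Order.min d1 d2 by rewrite lt_min d10.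
have dl0 : 0 < dl by rewrite divr_gt0.
have s10 : 0 < s1 by rewrite exprn_gt0.
have dlm : dl < Order.min d1 d2 by rewrite /dl ltr_pdivrMr// ltr_pMr// ltr1n.
have near s y : s <= s1 -> pball x s y -> Defs.edist x y < d1 /\ Defs.edist x y < d2.
  move=> ss /andP[_ ys]; have : Defs.edist x y <= dl.
    by rewrite -(ler_pXn2r d0) ?nnegrE ?sqrtr_ge0 ?(ltW dl0)// (le_trans ys).
  by move=> /le_lt_trans /(_ dlm); rewrite lt_min => /andP[].
have QballE s : Q (shell (wx x) 0 s) = lint (fun y => (bmu y * \1_(pball x s) y)%:E).
  rewrite QsetE; last exact: measurable_shell.
  apply: eq_lint => y; congr (_%:E); rewrite (_ : \1_(shell (wx x) 0 s) (y, false) = \1_(pball x s) y)//.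
  by rewrite (_ : \1_(shell (wx x) 0 s) (y, true) = \1_(pball x s) y)// -mulrDl subrK mul1r.
have i0 (E : set (d.-tuple R)) y : 0 <= (\1_E y : R) by rewrite indicE.
have ub s : 0 < s -> s <= s1 -> (Q (shell (wx x) 0 s) <= (2 * mu x)%:E * (s%:E * V))%E.
  move=> s0 ss; rewrite QballE /V -(lam_pball lamE x d0 s0) -lintc; last 2 first.
  - by rewrite mulr_ge0.
  - exact: measurable_pball.
  apply: le_lint => y; rewrite lee_fin ?mulr_ge0// indicE.
  have [|_] := boolP (y \in pball x s); last by rewrite !mulr0.
  rewrite inE => /(near _ _ ss)[/h1 + _]; rewrite ltr_norml !mulr1 => /andP[_ hy].
  rewrite /bmu; case: ifP => _; first by rewrite mulr_ge0.
  by move: hy mux; lra.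
have lb s : 0 < s -> s <= s1 -> ((mu x / 2)%:E * (s%:E * V) <= Q (shell (wx x) 0 s))%E.
  move=> s0 ss; rewrite QballE /V -(lam_pball lamE x d0 s0) -lintc; last 2 first.
  - exact: ltW.
  - exact: measurable_pball.
  (* [bmu] is 0 on [A], so the density is bounded below only on the ball minus [A], which gives the
     same integral. *)
  rewrite [leLHS](_ : _ = lint (fun y => (mu x / 2 * \1_(pball x s `\` A) y)%:E)); last first.
    apply: lintA => y; rewrite ?lee_fin ?mulr_ge0 ?(ltW mux2)// => Ay.
    congr (_%:E); congr (_ * _); rewrite !indicE; congr ((nat_of_bool _)%:R).
    by apply/idP/idP; rewrite !inE => //; case.
  apply: le_lint => y; rewrite lee_fin ?mulr_ge0 ?(ltW mux2)// indicE.
  have [|_] := boolP (y \in pball x s `\` A); last by rewrite mulr0 mulr_ge0.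
  rewrite inE => -[yE Ay]; rewrite indicE mem_set// !mulr1 bmuE//.
  have [/h1 + _] := near _ _ ss yE; rewrite ltr_norml => /andP[hy _].
  by move: hy; lra.
have V0 : (0 < V)%E by apply: (pball_vol_gt0 lamE d0 lamT).
have Qle1 (C : set T) : measurable C -> (Q C <= 1)%E.
  by move=> mC; rewrite -Q1; apply: le_measure => //; rewrite inE.
(* The unit ball has finite volume because a positive multiple of it is at most a probability. *)
have [v v0 vE] : exists2 v : R, 0 < v & V = v%:E.
  have := le_trans (lb _ s10 (lexx _)) (Qle1 _ (measurable_shell (mwx x) 0 s1)).
  case: V V0 => [v|_|//]; first by rewrite lte_fin => v0 _; exists v.
  by rewrite gt0_muley ?lte_fin// gt0_muley ?lte_fin.
pose ka := v * mu x; have ka0 : 0 < ka by rewrite mulr_gt0.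
have Qub s : 0 < s -> s <= s1 -> (Q (shell (wx x) 0 s) <= (2 * ka * s)%:E)%E.
  move=> s0 ss; apply: le_trans (ub s s0 ss) _; rewrite vE -!EFinM lee_fin /ka.
  by rewrite le_eqVlt; apply/orP; left; apply/eqP; ring.
have Qlb s : 0 < s -> s <= s1 -> ((ka * s / 2)%:E <= Q (shell (wx x) 0 s))%E.
  move=> s0 ss; apply: le_trans (lb s s0 ss); rewrite vE -!EFinM lee_fin /ka.
  by rewrite le_eqVlt; apply/orP; left; apply/eqP; field.
have Qflip s : 0 < s -> s <= s1 ->
    (Q (flipped (sx x) `&` shell (wx x) 0 s) = p%:E * Q (shell (wx x) 0 s))%E.
  move=> s0 ss; have mE := @measurable_pball R d x s.
  have mb : measurable_fun setT (fun y => (bmu y * \1_(pball x s) y)%:E).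
    by apply/measurable_EFinP; apply: measurable_funM => //; exact: measurable_indic.
  have b0 y : (0 <= (bmu y * \1_(pball x s) y)%:E)%E by rewrite lee_fin mulr_ge0.
  rewrite QballE QsetE; last first.
    by apply: measurableI; [exact: measurable_flipped|exact: measurable_shell].
  transitivity (lint (fun y => (p%:E * (bmu y * \1_(pball x s) y)%:E)%E)); last first.
    rewrite [in RHS]lamE// lamE ?ge0_integralZl_EFin ?(ltW p0)//.
      exact: emeasurable_funM.
    by move=> y; rewrite mule_ge0// lee_fin ltW.
  apply: lintA => y.
  - rewrite lee_fin mulr_ge0// addr_ge0// mulr_ge0 ?(ltW p0)//; by rewrite indicE.
  - by rewrite mule_ge0// lee_fin ltW.
  move=> Ay; rewrite -EFinM; congr (_%:E).
  have [yE|yE] := pselect (pball x s y); last first.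
    rewrite [\1_(pball x s) y]indicE memNset// !indicE memNset; last by case.
    by rewrite memNset ?mulr0 ?addr0 ?mulr0//; case.
  (* Here [f y = f x], so the vote of a draw at [y] is [-1] exactly when the coin flips its
     label. *)
  have [_ /h2 fyx] := near _ _ ss yE.
  rewrite [\1_(pball x s) y]indicE mem_set// indicE memNset; last first.
    move=> [+ _]; rewrite /flipped/= /sx/= !bfA// fyx.
    by case: (fE x) => ->; rewrite ?mulN1r ?mul1r ?opprK; lra.
  rewrite indicE mem_set; last first.
    split => //; rewrite /flipped/= /sx/= !bfA// fyx.
    by case: (fE x) => ->; rewrite ?mulN1r ?mul1r ?opprK.
  by rewrite mulr0 add0r !mulr1 mulrC.
have [M1 hM1] := interpolation_upper Q1 (mwx x) (msx x) (wx0 x) (sxE x) r1 p0 p49 ka0 s10 Qub Qlb Qflip.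
have [M2 hM2] := interpolation_lower Q1 (mwx x) (msx x) (wx0 x) (sxE x) r1 p0 ka0 s10 Qub Qlb Qflip.
exists (maxn M1 M2) => m; rewrite geq_max => /andP[/hM1 u /hM2 l]; split => //.
apply: le_trans l _; apply: le_iexp => s; first by case: ifP.
rewrite lee_fin /er /sc; case: ifP => [sn|_]; first by rewrite (ltW sn).
by case: ifP.
Qed.

(** Dominated convergence with the integrable bound [K * bmu]. Where [mu] vanishes the integrand is
    0, so eventual constancy is asked only where [mu x > 0]. *)
Let cvg_weighted (h : nat -> d.-tuple R -> \bar R) (K c : R) : 0 <= K ->
  (forall m, measurable_fun setT (h m)) ->
  (forall m x, (0 <= h m x <= K%:E)%E) -> 0 <= c ->
  (forall x, ~ A x -> 0 < mu x -> exists M : nat, forall m, (M <= m)%N -> h m x = c%:E) ->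
  (fun m => \int[lam]_x ((bmu x)%:E * h m x))%E @ \oo --> c%:E.
Proof.
move=> K0 mh hK c0 hc.
have mbE : measurable_fun setT (EFin \o bmu) by exact/measurable_EFinP.
have hbc (a : R) : 0 <= a -> (\int[lam]_x ((bmu x)%:E * a%:E) = a%:E)%E.
  move=> a0; under eq_integral do rewrite muleC.
  rewrite ge0_integralZl_EFin//; first by rewrite hb mule1.
  by move=> x _; rewrite lee_fin.
have mbc (a : R) : measurable_fun setT (fun x => ((bmu x)%:E * a%:E)%E).
  exact: emeasurable_funM.
case: (@dominated_convergence _ _ _ lam setT measurableT
  (fun m x => ((bmu x)%:E * h m x)%E) (fun x => ((bmu x)%:E * c%:E)%E)
  (fun x => ((bmu x)%:E * K%:E)%E)
  (fun m => emeasurable_funM mbE (mh m)) (mbc c)) => [| | |_ _]; last by rewrite hbc.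
- exists A; split => // x /= hx; apply: contrapT => Ax; apply: hx => _.
  have := mu0 x; rewrite le_eqVlt => /orP[/eqP mux|/(hc x Ax)[M hM]].
    rewrite bmuE// -mux mul0e; under eq_fun do rewrite mul0e.
    exact: cvg_cst.
  apply: cvg_near_cst; exists M => // m Mm.
  by rewrite hM.
- apply/integrableP; split; first exact: mbc.
  under eq_integral => x _.
    rewrite gee0_abs; last by rewrite mule_ge0 ?lee_fin.
    over.
  by rewrite hbc// ltry.
- apply: aeW => x m _; have /andP[h0 hK'] := hK m x.
  by rewrite gee0_abs ?mule_ge0 ?lee_fin// lee_wpmul2l ?lee_fin.
Qed.

(** The pointwise error [pi m x] is only known to be eventually between two bounds. Its minimum with
    the lower bound, and its maximum with the upper one, are eventually constant, so their weighted
    integrals converge and enclose the expected error. *)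
Lemma nw_error_bounds :
  ((lower_const r * p)%:E <= limn_einf (exp_err mu f p beta))%E /\
  (limn_esup (exp_err mu f p beta) <=
    (upper_const r * (ln (1 / p)) `^ (1 / (1 - r^-1)) * p)%:E)%E.
Proof.
have [g0 _] := geom_gt0 r1.
set lo := lower_const r * p; set up := upper_const r * _ * p.
have lo0 : 0 <= lo.
  rewrite mulr_ge0 ?(ltW p0)// /lower_const divr_ge0// invr_ge0 addr_ge0//.
  by rewrite mulr_ge0 ?powR_ge0// mulr_ge0// ltW.
have up0 : 0 <= up.
  rewrite mulr_ge0 ?(ltW p0)// mulr_ge0 ?powR_ge0// mulr_ge0 ?powR_ge0//.
  by rewrite addr_ge0// mulr_ge0// ltW.
have mcst (c : R) : measurable_fun [set: d.-tuple R] (fun=> c%:E) by [].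
split.
- have /cvg_limn_einf_sup[cl _] :
      (fun m => \int[lam]_x ((bmu x)%:E * mine (pi m x) lo%:E))%E @ \oo --> lo%:E.
    apply: (@cvg_weighted _ 1) => // [m|m x|x Ax /(pi_eventually Ax)[M hM]].
    + exact: measurable_mine.
    + by rewrite le_min pi0 lee_fin lo0/= ge_min pi1.
    + by exists M => m /hM[h _]; apply/min_idPr.
  rewrite -[leLHS]cl; apply: le_limn_einf => m.
  rewrite exp_errE; apply: ge0_le_integral_any => x.
    by rewrite mule_ge0 ?lee_fin// le_min pi0 lee_fin.
  by rewrite lee_wpmul2l ?lee_fin// ge_min lexx.
- have /cvg_limn_einf_sup[_ cl] :
      (fun m => \int[lam]_x ((bmu x)%:E * maxe (pi m x) up%:E))%E @ \oo --> up%:E.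
    apply: (@cvg_weighted _ (1 + up)) => // [|m|m x|x Ax /(pi_eventually Ax)[M hM]].
    + exact: addr_ge0.
    + exact: measurable_maxe.
    + rewrite le_max pi0/= ge_max lee_fin lerDr ler01 andbT.
      by rewrite (le_trans (pi1 m x))// lee_fin lerDl.
    + by exists M => m /hM[_ h]; apply/max_idPr.
  rewrite -[leRHS]cl; apply: le_limn_esup => m.
  rewrite exp_errE; apply: ge0_le_integral_any => x; first by rewrite mule_ge0 ?lee_fin.
  by rewrite lee_wpmul2l ?lee_fin// le_max lexx.
Qed.

End nadaraya_watson.

(** * Positivity of the constants and size of the exponent *)

Section constants.
Context (R : realType).

Lemma lower_const_gt0 (r : R) : 1 < r -> 0 < lower_const r.
Proof.
move=> r1; have [g0 _] := geom_gt0 r1.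
by rewrite divr_gt0// invr_gt0 addr_gt0// mulr_gt0 ?powR_gt0// mulr_gt0.
Qed.

Lemma upper_const_gt0 (r : R) : 1 < r -> 0 < upper_const r.
Proof.
move=> r1; have [g0 _] := geom_gt0 r1.
by rewrite mulr_gt0 ?powR_gt0// addr_gt0// mulr_gt0.
Qed.

(** The base is at least 1 because [2^r >= 1 + r / 2], and the exponent [1 / (r - 1)] is
    nonnegative. *)
Lemma c_exp_ge1 (r : R) : 1 < r -> 1 <= c_exp r.
Proof.
move=> r1; have rm1 : 0 < r - 1 by rewrite subr_gt0.
(* From [ln (1 + x) <= x] at [x = - 1 / 2], since [ln 2 = - ln (1 / 2)]. *)
have ln2 : 1 / 2 <= ln (2 : R).
  have : ln (1 + - (1 / 2)) <= - (1 / 2) :> R by apply: le_ln1Dx; lra.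
  rewrite [X in ln X](_ : _ = 2^-1); last by lra.
  by rewrite lnV ?posrE//; lra.
have h2 : 1 + r * (1 / 2) <= 2 `^ r.
  rewrite /powR pnatr_eq0/=; apply: le_trans (expR_ge1Dx _).
  by rewrite lerD2l ler_pM2l//; lra.
have h1 : 1 <= 8 * 2 `^ r / (r - 1) by rewrite ler_pdivlMr// mul1r; lra.
have e0 : 0 <= 1 / (r - 1) by rewrite divr_ge0// ltW.
by have := ler_powR h1 e0; rewrite powRr0.
Qed.

End constants.

(** * The bounds on the asymptotic clean error *)

Theorem theorem3 (R : realType) :
  exists C1 C2 : R -> R,
    (forall r : R, 1 < r -> 0 < C1 r /\ 0 < C2 r) /\
    forall (d : nat) (beta : R) (mu f : d.-tuple R -> R),
      (0 < d)%N -> d%:R < beta ->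
      prob_density mu ->
      (forall x, f x = 1 \/ f x = -1) ->
      regular mu f ->
      forall p : R, 0 < p -> p < 49 / 100 ->
        ((C1 (beta / d%:R) * p `^ (c_exp (beta / d%:R)))%:E
           <= limn_einf (exp_err mu f p beta))%E /\
        (limn_esup (exp_err mu f p beta)
           <= (C2 (beta / d%:R) * (ln (1 / p)) `^ (1 / (1 - d%:R / beta)) * p)%:E)%E.
Proof.
exists (@lower_const R), (@upper_const R); split.
  by move=> r r1; split; [exact: lower_const_gt0|exact: upper_const_gt0].
move=> d beta mu f d0 dbeta [mu0 mu1] fE [cmu cf] p p0 p49.
have r1 : 1 < beta / d%:R by rewrite ltr_pdivlMr ?mul1r// ltr0n.
have [lam lamE] := lint_measure R d.
have [A1 [mA1 [cA1 A10]]] := cmu; have [A2 [mA2 [cA2 A20]]] := cf.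
pose A := A1 `|` A2.
have mA : measurable A by exact: measurableU.
have A0 : lam A = 0%E.
  apply: null_set_setU => //; first exact: etrans (esym (leb_volE lamE mA1)) A10.
  exact: etrans (esym (leb_volE lamE mA2)) A20.
have cmuA x : ~ A x -> cont_at mu x.
  by move=> Ax; apply: contrapT => h; apply: Ax; left; exact: cA1.
have cfA x : ~ A x -> loc_const_at f x.
  by move=> Ax; apply: contrapT => h; apply: Ax; right; exact: cA2.
(* The same Borel version of [mu] as in [nw_error_bounds], needed here to construct the law [Q] that
   it takes as an argument. *)
pose bmu x := if `[< A x >] then 0 else mu x.
have mbmu : measurable_fun setT bmu by exact: measurable_cont_off.
have bmu0 x : 0 <= bmu x by rewrite /bmu; case: ifP.
have bmu1 : lint (fun x => (bmu x)%:E) = 1%E.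
  rewrite -mu1; apply: (lint_null_eq mA); rewrite ?(leb_volE lamE)// => x Ax.
  by rewrite /bmu; case: asboolP.
have p01 : 0 <= p <= 1 by rewrite ltW//=; lra.
have [Q QE] := law_exists lamE mbmu bmu0 bmu1 p01.
have [lo up] := nw_error_bounds lamE d0 dbeta mu0 mu1 fE mA A0 cmuA cfA p0 p49 QE.
split; last by move: up; rewrite invf_div.
(* The bound obtained is linear in [p]; it implies the stated one because [p <= 1] and [c_exp >= 1]
   give [p^c <= p]. *)
apply: le_trans lo; rewrite lee_fin ler_pM2l ?lower_const_gt0//.
apply: ge1r_powR; last exact: c_exp_ge1.
by rewrite p0/=; lra.
Qed.
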